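(* There exists no 3-dimensional non-Sasakian locally $\phi$-recurrent $(\kappa,\mu)$-contact metric manifold which is not locally $\phi$-symmetric.
   Context: A contact metric manifold $M^{2n+1}(\phi,\xi,\eta,g)$ is a smooth $(2n+1)$-dimensional manifold with a global 1-form $\eta$ satisfying $\eta\wedge(d\eta)^n\neq 0$ everywhere, a global vector field $\xi$, a $(1,1)$-tensor field $\phi$ and a Riemannian metric $g$ such that $\eta(\xi)=1$, $\phi^2=-\mathrm{Id}+\eta\otimes\xi$, $g(\phi X,\phi Y)=g(X,Y)-\eta(X)\eta(Y)$ and $d\eta(X,Y)=g(X,\phi Y)$ for all vector fields $X,Y$, with the convention $d\eta(X,Y)=\frac12\big(X\eta(Y)-Y\eta(X)-\eta([X,Y])\big)$. Let $\nabla$ be the Levi-Civita connection of $g$ and $R(X,Y)Z=\nabla_X\nabla_YZ-\nabla_Y\nabla_XZ-\nabla_{[X,Y]}Z$ its curvature tensor. Put $hX=\frac12(\mathcal{L}_\xi\phi)X$, where $\mathcal{L}$ is the Lie derivative. For real constants $(\kappa,\mu)\in\mathbb{R}^2$, a contact metric manifold is a $(\kappa,\mu)$-contact metric manifold if $R(X,Y)\xi=\kappa(\eta(Y)X-\eta(X)Y)+\mu(\eta(Y)hX-\eta(X)hY)$ for all vector fields $X,Y$. One always has $\kappa\leq 1$, and the manifold is Sasakian if and only if $\kappa=1$ (in which case $h=0$); in general a contact metric manifold is Sasakian if and only if $R(X,Y)\xi=\eta(Y)X-\eta(X)Y$ for all $X,Y$. A contact metric manifold is locally $\phi$-symmetric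 if $\phi^2((\nabla_WR)(X,Y)Z)=0$ for all vector fields $W,X,Y,Z$ orthogonal to $\xi$. It is locally $\phi$-recurrent if there exists a non-zero 1-form $A$ such that $\phi^2((\nabla_WR)(X,Y)Z)=A(W)R(X,Y)Z$ for all vector fields $W,X,Y,Z$ orthogonal to $\xi$. *)

(* Defs.v *)
From HB Require Import structures.
From mathcomp Require Import all_boot all_order all_algebra all_fingroup.
From mathcomp Require Import all_classical all_reals all_analysis.

Set Implicit Arguments.
Unset Strict Implicit.
Unset Printing Implicit Defensive.

Import Order.TTheory GRing.Theory Num.Theory.
Import numFieldNormedType.Exports.

Local Open Scope classical_set_scope.
Local Open Scope ring_scope.

(* C^k on D: k successive directional derivatives, each stage being Frechet
   differentiable, the last one continuous.  Meant for open D. *)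
Fixpoint Ck (R : realType) (m k : nat) (D : set 'rV[R]_m) (f : 'rV[R]_m -> R)
    {struct k} : Prop :=
  match k with
  | 0 => forall x, D x -> {for x, continuous f}
  | k'.+1 => (forall x, D x -> differentiable f x) /\
             (forall v, Ck k' D ('D_v f))
  end.

Definition Cinfty (R : realType) (m : nat) (D : set 'rV[R]_m)
    (f : 'rV[R]_m -> R) : Prop := forall k, Ck k D f.

(* [fwd] and [bwd] are total functions, meaningful only on [dom] and on its
   image respectively. *)
Record chart (R : realType) (m : nat) (M : topologicalType) := Chart {
  dom : set M ;
  fwd : M -> 'rV[R]_m ;
  bwd : 'rV[R]_m -> M ;
  dom_open : open dom ;
  img_open : open (fwd @` dom) ;
  fwdK : forall p, dom p -> bwd (fwd p) = p ;
  fwd_continuous : forall p, dom p -> {for p, continuous fwd} ;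
  bwd_continuous : forall x, (fwd @` dom) x -> {for x, continuous bwd}
}.

(* A smooth structure is presented by an atlas indexed by the points of M: a
   chart around each point, with smooth transition maps.  The chart
   [chart_at p] also identifies the tangent space at p with R^m. *)
Record smoothManifold (R : realType) (m : nat) := SmoothManifold {
  carrier :> topologicalType ;
  chart_at : carrier -> chart R m carrier ;
  mem_chart_at : forall p, dom (chart_at p) p ;
  transition_smooth : forall p q i,
    Cinfty (fwd (chart_at p) @` (dom (chart_at p) `&` dom (chart_at q)))
      (fun x => fwd (chart_at q) (bwd (chart_at p) x) ord0 i) ;
  carrier_hausdorff : hausdorff_space carrier ;
  carrier_second_countable : @second_countable carrier
}.

Section Calculus.
Variables (R : realType) (m : nat) (M : smoothManifold R m).

Definition smooth_on (U : set M) (f : M -> R) : Prop :=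
  forall p, Cinfty (fwd (chart_at p) @` (dom (chart_at p) `&` U))
              (f \o bwd (chart_at p)).

Definition smooth (f : M -> R) : Prop := smooth_on setT f.

(* The value at p of each field below is given by its components in the
   coordinates of [chart_at p].  Vectors are rows, so an endomorphism acts by
   right multiplication. *)
Definition vfield := M -> 'rV[R]_m.
Definition form1 := M -> 'cV[R]_m.
Definition tensor11 := M -> 'M[R]_m.
Definition tensor02 := M -> 'M[R]_m.

(* the function X f *)
Definition vapp (X : vfield) (f : M -> R) : M -> R := fun p =>
  'D_(X p) (f \o bwd (chart_at p)) (fwd (chart_at p) p).

Definition coordf (q : M) (i : 'I_m) : M -> R :=
  fun p => fwd (chart_at q) p ord0 i.

(* [vapp X (coordf q i)] is the i-th component of X in [chart_at q]. *)
Definition smooth_vf (X : vfield) : Prop :=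
  forall q i, smooth_on (dom (chart_at q)) (vapp X (coordf q i)).

Definition vscale (f : M -> R) (X : vfield) : vfield := fun p => f p *: X p.

(* The component of [X, Y] along x^i is [X, Y] x^i = X (Y x^i) - Y (X x^i). *)
Definition bracket (X Y : vfield) : vfield := fun p =>
  \row_i (vapp X (vapp Y (coordf p i)) p - vapp Y (vapp X (coordf p i)) p).

Definition ev1 (w : form1) (X : vfield) : M -> R :=
  fun p => (X p *m w p) ord0 ord0.

Definition ev11 (F : tensor11) (X : vfield) : vfield := fun p => X p *m F p.

Definition ev02 (g : tensor02) (X Y : vfield) : M -> R :=
  fun p => (X p *m g p *m (Y p)^T) ord0 ord0.

Definition smooth_form1 (w : form1) : Prop :=
  forall X, smooth_vf X -> smooth (ev1 w X).

Definition smooth_tensor11 (F : tensor11) : Prop :=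
  forall X, smooth_vf X -> smooth_vf (ev11 F X).

Definition smooth_tensor02 (g : tensor02) : Prop :=
  forall X Y, smooth_vf X -> smooth_vf Y -> smooth (ev02 g X Y).

Definition riemannian_metric (g : tensor02) : Prop :=
  [/\ smooth_tensor02 g,
      forall p, (g p)^T = g p
    & forall p (v : 'rV[R]_m), v != 0 -> 0 < (v *m g p *m v^T) ord0 ord0].

(* exterior derivative with the factor 1/2 convention *)
Definition dform (w : form1) (X Y : vfield) : M -> R := fun p =>
  2^-1 * (vapp X (ev1 w Y) p - vapp Y (ev1 w X) p - ev1 w (bracket X Y) p).

(* Lie derivative of a (1,1)-tensor field *)
Definition lie11 (X : vfield) (F : tensor11) (Y : vfield) : vfield :=
  bracket X (ev11 F Y) \- ev11 F (bracket X Y).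

Definition connection := vfield -> vfield -> vfield.

Definition levi_civita (g : tensor02) (D : connection) : Prop :=
  (forall X Y, smooth_vf X -> smooth_vf Y -> smooth_vf (D X Y)) /\
  (forall X X' Y, smooth_vf X -> smooth_vf X' -> smooth_vf Y ->
     D (X \+ X') Y = D X Y \+ D X' Y) /\
  (forall f X Y, smooth f -> smooth_vf X -> smooth_vf Y ->
     D (vscale f X) Y = vscale f (D X Y)) /\
  (forall X Y Y', smooth_vf X -> smooth_vf Y -> smooth_vf Y' ->
     D X (Y \+ Y') = D X Y \+ D X Y') /\
  (forall f X Y, smooth f -> smooth_vf X -> smooth_vf Y ->
     D X (vscale f Y) = vscale (vapp X f) Y \+ vscale f (D X Y)) /\
  (forall X Y, smooth_vf X -> smooth_vf Y ->
     D X Y \- D Y X = bracket X Y) /\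
  (forall X Y Z, smooth_vf X -> smooth_vf Y -> smooth_vf Z ->
     vapp X (ev02 g Y Z) = ev02 g (D X Y) Z \+ ev02 g Y (D X Z)).

Definition curv (D : connection) (X Y Z : vfield) : vfield :=
  (D X (D Y Z) \- D Y (D X Z)) \- D (bracket X Y) Z.

(* (D_W R)(X, Y) Z *)
Definition dcurv (D : connection) (W X Y Z : vfield) : vfield :=
  ((D W (curv D X Y Z) \- curv D (D W X) Y Z) \- curv D X (D W Y) Z)
  \- curv D X Y (D W Z).

End Calculus.

Section Contact.
Variables (R : realType) (n : nat).

(* (w /\ (dw)^n)(X_0, ..., X_2n) at p, up to the positive constant fixed by the
   normalization of the wedge product *)
Definition contact_volume (M : smoothManifold R n.*2.+1) (w : form1 M)
    (X : 'I_n.*2.+1 -> vfield M) (p : M) : R :=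
  \sum_(s : 'S_n.*2.+1) (-1) ^+ s * ev1 w (X (s ord0)) p *
    \prod_(i < n) dform w (X (s (inord i.*2.+1))) (X (s (inord i.*2.+2))) p.

Record contactMetricManifold := ContactMetricManifold {
  cm_manifold :> smoothManifold R n.*2.+1 ;
  cm_phi : tensor11 cm_manifold ;
  cm_xi : vfield cm_manifold ;
  cm_eta : form1 cm_manifold ;
  cm_g : tensor02 cm_manifold ;
  cm_phi_smooth : smooth_tensor11 cm_phi ;
  cm_xi_smooth : smooth_vf cm_xi ;
  cm_eta_smooth : smooth_form1 cm_eta ;
  cm_g_riemannian : riemannian_metric cm_g ;
  cm_eta_contact : forall p, exists X : 'I_n.*2.+1 -> vfield cm_manifold,
    (forall i, smooth_vf (X i)) /\ contact_volume cm_eta X p != 0 ;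
  cm_eta_xi : forall p, ev1 cm_eta cm_xi p = 1 ;
  cm_phi2 : forall X p, smooth_vf X ->
    ev11 cm_phi (ev11 cm_phi X) p = - X p + ev1 cm_eta X p *: cm_xi p ;
  cm_compat : forall X Y p, smooth_vf X -> smooth_vf Y ->
    ev02 cm_g (ev11 cm_phi X) (ev11 cm_phi Y) p
    = ev02 cm_g X Y p - ev1 cm_eta X p * ev1 cm_eta Y p ;
  cm_deta : forall X Y p, smooth_vf X -> smooth_vf Y ->
    dform cm_eta X Y p = ev02 cm_g X (ev11 cm_phi Y) p
}.

Arguments cm_phi : clear implicits.
Arguments cm_xi : clear implicits.
Arguments cm_eta : clear implicits.
Arguments cm_g : clear implicits.

Variable M : contactMetricManifold.

Definition cm_h (X : vfield M) : vfield M :=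
  fun p => 2^-1 *: lie11 (cm_xi M) (cm_phi M) X p.

Definition kappa_mu (D : connection M) (kappa mu : R) : Prop :=
  forall X Y p, smooth_vf X -> smooth_vf Y ->
    curv D X Y (cm_xi M) p
    = kappa *: (ev1 (cm_eta M) Y p *: X p - ev1 (cm_eta M) X p *: Y p)
      + mu *: (ev1 (cm_eta M) Y p *: cm_h X p
               - ev1 (cm_eta M) X p *: cm_h Y p).

(* R(X, Y) xi = eta(Y) X - eta(X) Y: on contact metric manifolds this curvature
   identity is equivalent to normality. *)
Definition sasakian (D : connection M) : Prop :=
  forall X Y p, smooth_vf X -> smooth_vf Y ->
    curv D X Y (cm_xi M) p
    = ev1 (cm_eta M) Y p *: X p - ev1 (cm_eta M) X p *: Y p.

Definition horizontal (X : vfield M) : Prop :=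
  smooth_vf X /\ forall p, ev02 (cm_g M) X (cm_xi M) p = 0.

Definition locally_phi_symmetric (D : connection M) : Prop :=
  forall W X Y Z p,
    horizontal W -> horizontal X -> horizontal Y -> horizontal Z ->
    ev11 (cm_phi M) (ev11 (cm_phi M) (dcurv D W X Y Z)) p = 0.

(* "non-zero" means not identically zero *)
Definition locally_phi_recurrent (D : connection M) : Prop :=
  exists A : form1 M,
    [/\ smooth_form1 A, exists p, A p != 0
      & forall W X Y Z p,
          horizontal W -> horizontal X -> horizontal Y -> horizontal Z ->
          ev11 (cm_phi M) (ev11 (cm_phi M) (dcurv D W X Y Z)) p
          = ev1 A W p *: curv D X Y Z p].

End Contact.

Arguments cm_phi {R n} c.
Arguments cm_xi {R n} c.
Arguments cm_eta {R n} c.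
Arguments cm_g {R n} c.

(* Main.v *)
From HB Require Import structures.
From mathcomp Require Import all_boot all_order all_algebra all_fingroup.
From mathcomp Require Import all_classical all_reals all_analysis.
From mathcomp Require Import ring lra.
Require Import Defs.

(** A 3-dimensional contact metric manifold that satisfies the (kappa, mu)-condition
    and is not Sasakian is locally phi-symmetric: the sectional curvature of the
    contact planes is the constant -(kappa + mu), and this constancy annihilates
    the horizontal part of nabla R.  Throughout, <.,.> is the metric, D its
    Levi-Civita connection, eta(V) = <V, xi>, and h = (L_xi phi) / 2.

    All computations are made in moving frames (X, phi X, xi) with X a global
    horizontal field, not normalized: the expansion
      |X|^2 V = <V, X> X + <V, phi X> phi X + |X|^2 eta(V) xi
    of [frame_expand] holds at every point, including the zeros of X, so neither
    local sections nor cut-off functions are needed.  A field X that does not vanish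
    at a given point comes from the contact condition ([exists_horizontal]).

    The (1,1)-tensor V |-> D_V xi is determined by three facts.  Its antisymmetric
    part is d eta; its part that does not commute with phi is h ([htenE]); and the
    (kappa, mu)-condition for R(., xi) xi gives, by antisymmetrization, that it is
    trace-free ([trace_Dxi]) and, by taking the trace, that |h X|^2 = (1 - kappa) |X|^2
    ([norm_Dxi]).  Hence kappa <= 1.  If kappa = 1 then h = 0 and the
    (kappa, mu)-condition is the Sasakian one ([sasakian_kappa1]).

    If kappa < 1, put l = sqrt (1 - kappa) > 0.  The field h X + l X, suitably
    rescaled, is an eigenfield E of h for l ([exists_eigenframe]).  With F = phi E, the
    equation R(E, F) xi = 0 yields <D_E F, E> = <D_F F, E> = 0, because l <> 0, and
    R(E, xi) xi = (kappa + mu l) E yields <D_xi F, E> = mu |E|^2 / 2.  So the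
    connection form of the contact planes is <D_V F, E> = mu eta(V) |E|^2 / 2
    ([conn_form]); differentiating it gives the curvature of the contact planes
    ([Rm_FE], [Rm_horizontal]):
      <R(X, Y) Z, V> = -(kappa + mu) (<Y, Z> <X, V> - <X, Z> <Y, V>)
    for Z, V horizontal and X, Y arbitrary.  The right-hand side is parallel up to
    terms with a factor eta, and those vanish by the (kappa, mu)-condition
    ([dcurv_horizontal]).

    The analysis that this rests on is [X, Y] f = X (Y f) - Y (X f)
    ([vapp_bracket]), that is, Clairaut's theorem ([derive_comm]) read in a chart; it
    makes R(X, Y) skew for the metric ([Rm_skew]). *)

Set Implicit Arguments.
Unset Strict Implicit.
Unset Printing Implicit Defensive.

Import Order.TTheory GRing.Theory Num.Theory.
Import numFieldNormedType.Exports.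

Local Open Scope classical_set_scope.
Local Open Scope ring_scope.

(** * C^k functions and the symmetry of second derivatives *)

(** Add to f the function g - f, which vanishes near x and so has differential 0. *)
Lemma near_eq_differentiable (K : numFieldType) (V W : normedModType K)
    (f g : V -> W) (x : V) :
  (\near x, f x = g x) -> differentiable f x -> differentiable g x.
Proof.
move=> fg df; have -> : g = f + (g - f) by apply/funext => y; rewrite !fctE subrKC.
apply: differentiableD => //.
have h0 : \near x, (g - f) x = 0.
  by near=> y; rewrite !fctE (near fg y) ?subrr.
have hx : (g - f) x = 0 by exact: nbhs_singleton h0.
move: (g - f : V -> W) h0 hx => h h0 hx.
have e : h \o shift x = cst (h x) + (\0 : {linear V -> W}) +o_ 0 id.
  apply/eqaddoP => e e0; near=> y.
  rewrite !fctE /= hx !addr0 subr0.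
  have -> : h (y + x) = 0.
    near: y.
    by move: h0; rewrite (near_shift 0) /=; apply: filterS => z /=; rewrite subr0.
  by rewrite normr0 mulr_ge0 // ltW.
have c0 : continuous (\0 : {linear V -> W}) by exact: cst_continuous.
by apply/diff_locallyP; rewrite (diff_unique c0 e).
Unshelve. all: by end_near. Qed.

Lemma near_eq_continuous (T U : topologicalType) (f g : T -> U) (x : T) :
  (\near x, f x = g x) -> {for x, continuous f} -> {for x, continuous g}.
Proof.
move=> fg cf; rewrite /prop_for /continuous_at -(nbhs_singleton fg).
by apply: cvg_trans cf; apply: near_eq_cvg.
Qed.

Section CkTheory.
Variables (R : realType) (m : nat).
Implicit Types (D : set 'rV[R]_m) (f g : 'rV[R]_m -> R) (x v : 'rV[R]_m).

Lemma open_near D x : open D -> D x -> \near x, D x.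
Proof. by move=> oD Dx; apply: open_nbhs_nbhs. Qed.

Lemma near_eq_on D f g x : open D -> D x -> (forall y, D y -> f y = g y) ->
  \near x, f x = g x.
Proof.
by move=> oD Dx fg; apply: filterS (open_near oD Dx) => y /fg.
Qed.

Lemma Ck_ext k D f g : open D -> (forall x, D x -> f x = g x) ->
  Ck k D f -> Ck k D g.
Proof.
elim: k f g => [|k IH] f g oD fg /=.
  by move=> cf x Dx; apply: near_eq_continuous (cf x Dx); exact: near_eq_on oD Dx fg.
move=> [df dDf]; split.
  by move=> x Dx; apply: near_eq_differentiable (df x Dx); exact: near_eq_on oD Dx fg.
move=> v; apply: IH (dDf v) => // x Dx.
by apply: near_eq_derive; exact: near_eq_on oD Dx fg.
Qed.

Lemma Ck_cst k D (c : R) : Ck k D (cst c).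
Proof.
elim: k c => [|k IH] c /=; first by move=> x _; exact: cst_continuous.
split=> [x _|v]; first exact: differentiable_cst.
suff -> : 'D_v (cst c) = cst (0 : R) by [].
by apply/funext => x; exact: derive_cst.
Qed.

Lemma Ck_add k D f g : open D ->
  Ck k D f -> Ck k D g -> Ck k D (fun x => f x + g x).
Proof.
elim: k f g => [|k IH] f g oD /=.
  by move=> cf cg x Dx; exact: (continuousD (cf x Dx) (cg x Dx)).
move=> [df dDf] [dg dDg]; split=> [x Dx|v].
  exact: (differentiableD (df x Dx) (dg x Dx)).
apply: Ck_ext (IH _ _ oD (dDf v) (dDg v)) => // x Dx.
by rewrite [RHS](@deriveD _ _ _ f g) //; apply: diff_derivable; [exact: df|exact: dg].
Qed.

Lemma CinftyP D f : Cinfty D f ->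
  (forall x, D x -> differentiable f x) /\ forall v, Cinfty D ('D_v f).
Proof.
move=> cf; split; first by have [] : _ /\ _ := cf 1%N.
by move=> v k; have [_] : _ /\ _ := cf k.+1; apply.
Qed.

(** By induction on k for all f, g at once: D_v (f g) is a sum of two products of
    smooth functions.  Smooth factors, rather than C^k ones, spare the inclusion of
    C^(k+1) in C^k. *)
Lemma Cinfty_mul D f g : open D ->
  Cinfty D f -> Cinfty D g -> Cinfty D (fun x => f x * g x).
Proof.
move=> oD cf cg k; elim: k f g cf cg => [|k IH] f g cf cg /=.
  by move=> x Dx; exact: (continuousM (cf 0%N x Dx) (cg 0%N x Dx)).
have [df dDf] := CinftyP cf; have [dg dDg] := CinftyP cg.
split=> [x Dx|v]; first exact: (differentiableM (df x Dx) (dg x Dx)).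
apply: Ck_ext (Ck_add oD (IH _ _ cf (dDg v)) (IH _ _ (dDf v) cg)) => // x Dx.
rewrite [RHS](@deriveM _ _ f g); last 2 first.
- exact: diff_derivable (df x Dx).
- exact: diff_derivable (dg x Dx).
by rewrite /GRing.scale /=; ring.
Qed.

Lemma Cinfty_ext D f g : open D -> (forall x, D x -> f x = g x) ->
  Cinfty D f -> Cinfty D g.
Proof. by move=> oD fg cf k; apply: Ck_ext (cf k). Qed.

Lemma is_derive_line (F : 'rV[R]_m -> R) (y v : 'rV[R]_m) (r : R) :
  differentiable F (y + r *: v) ->
  is_derive r 1 (fun t : R => F (y + t *: v)) ('D_v F (y + r *: v)).
Proof.
move=> dfF; have dF : derivable F (y + r *: v) v by exact: diff_derivable.
have e : (fun h : R => h^-1 *: ((fun t : R => F (y + t *: v)) (h *: (1 : R) + r)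
            - F (y + r *: v)))
       = (fun h : R => h^-1 *: (F (h *: v + (y + r *: v)) - F (y + r *: v))).
  apply/funext => h; congr (_ *: (F _ - _)).
  by rewrite [h *: 1]mulr1 scalerDl addrCA.
by split; rewrite /derivable /derive e.
Qed.

(** The mixed second difference over a parallelogram of side s is s^2 D_w D_v F + o(s^2):
    by the mean value theorem in the direction v it is s times an increment of D_v F,
    which differentiability of D_v F at x alone evaluates. *)
Lemma second_difference D (F : 'rV[R]_m -> R) (x v w : 'rV[R]_m) : open D -> D x ->
  (forall y, D y -> differentiable F y) -> differentiable ('D_v F) x ->
  forall e : R, 0 < e -> exists2 d : R, 0 < d & forall s : R, 0 < s < d ->
   `|F (x + s *: w + s *: v) - F (x + s *: v) - F (x + s *: w) + F x
     - s ^+ 2 * 'D_w ('D_v F) x| <= e * s ^+ 2.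
Proof.
move=> oD Dx dF dG e e0.
pose G := 'D_v F; pose b := `|v| + `|w|.
have b0 : 0 <= b by rewrite addr_ge0.
pose e' := e / (2 * b + 1).
have e'0 : 0 < e' by rewrite divr_gt0 // ltr_wpDl // mulr_ge0.
have /eqaddoP/(_ _ e'0)/nbhs_normP[d1 /= d10 H1] := diff_locally dG.
have /nbhs_normP[d2 /= d20 H2] := open_near oD Dx.
pose d := Num.min d1 d2 / (b + 1).
have b1 : 0 < b + 1 by rewrite ltr_wpDl.
exists d; first by rewrite divr_gt0 // lt_min d10 d20.
move=> s /andP[s0 sd].
have sbd : s * b < Num.min d1 d2.
  by rewrite (le_lt_trans (y := s * (b + 1))) ?ler_pM2l ?lerDl // -ltr_pdivlMr.
have small r t : 0 <= r <= s -> 0 <= t <= s -> `|r *: v + t *: w| <= s * b.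
  move=> /andP[r0 rs] /andP[t0 ts]; apply: le_trans (ler_normD _ _) _.
  by rewrite !normrZ !ger0_norm // mulrDr lerD // ler_wpM2r.
have inD r t : 0 <= r <= s -> 0 <= t <= s -> D (x + t *: w + r *: v).
  move=> hr ht; apply: H2 => /=.
  rewrite -addrA opprD addNKr normrN addrC (le_lt_trans (small _ _ hr ht)) //.
  by rewrite (lt_le_trans sbd) // ge_min lexx orbT.
have approx r t : 0 <= r <= s -> 0 <= t <= s ->
    `|G (x + t *: w + r *: v) - G x - 'd G x (r *: v + t *: w)| <= e' * (s * b).
  move=> hr ht.
  have := H1 (r *: v + t *: w); rewrite /= sub0r normrN; move=> /(_ _)/wrap[].
    by rewrite (le_lt_trans (small _ _ hr ht)) // (lt_le_trans sbd) // ge_min lexx.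
  rewrite !fctE /= opprD addrA -/G (_ : r *: v + t *: w + x = x + t *: w + r *: v).
    by move=> /le_trans; apply; rewrite ler_pM2l //; exact: small.
  by rewrite addrC -addrA; congr (_ + _); rewrite addrC.
have phi' r : 0 <= r <= s -> is_derive r 1
    (fun t : R => F (x + s *: w + t *: v) - F (x + 0 *: w + t *: v))
    (G (x + s *: w + r *: v) - G (x + 0 *: w + r *: v)).
  move=> hr; apply: is_deriveB; apply: is_derive_line; apply: dF; apply: inD => //;
  by rewrite ?lexx ltW.
have h1 r : r \in `]0, s[%R -> is_derive r 1
    (fun t : R => F (x + s *: w + t *: v) - F (x + 0 *: w + t *: v))
    (G (x + s *: w + r *: v) - G (x + 0 *: w + r *: v)).
  by rewrite in_itv /= => /andP[r0 rs]; apply: phi'; rewrite !ltW.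
have h2 : {within `[0, s], continuous
    (fun t : R => F (x + s *: w + t *: v) - F (x + 0 *: w + t *: v))}.
  apply: continuous_in_subspaceT => r; rewrite inE /= in_itv /= => hr.
  have [dr _] := phi' r hr.
  by apply/differentiable_continuous/derivable1_diffP.
have [c cs] := MVT s0 h1 h2.
move: cs; rewrite in_itv /= => /andP[/ltW c0 /ltW cs].
have hc : 0 <= c <= s by rewrite c0 cs.
rewrite !scale0r !addr0 subr0 => E.
have -> : F (x + s *: w + s *: v) - F (x + s *: v) - F (x + s *: w) + F x =
  F (x + s *: w + s *: v) - F (x + s *: v) - (F (x + s *: w) - F x) by rewrite opprD opprK addrA.
rewrite E.
have hs : 0 <= s <= s by rewrite lexx ltW.
have h0 : 0 <= (0 : R) <= s by rewrite lexx ltW.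
have A1 := approx _ _ hc h0; have A2 := approx _ _ hc hs.
have dE : 'd G x (c *: v + s *: w) = 'd G x (c *: v) + s *: 'D_w G x.
  by rewrite (deriveE w dG) linearD; congr (_ + _); rewrite linearZ.
rewrite dE in A2; rewrite !scale0r !addr0 in A1.
set y := 'd G x _ in A1 A2; set L := 'D_w G x in A2 *.
have K : 2 * (e' * (s * b)) <= e * s.
  rewrite (_ : 2 * _ = (e' * (2 * b)) * s); last by ring.
  rewrite ler_pM2r // mulrAC ler_pdivrMr ?ltr_wpDl ?mulr_ge0 //.
  by rewrite ler_pM2l // lerDl.
rewrite (_ : _ - _ = s * ((G (x + s *: w + c *: v) - G x - (y + s *: L))
   - (G (x + c *: v) - G x - y))); last by rewrite /GRing.scale /=; ring.
rewrite normrM gtr0_norm // expr2 mulrA mulrC ler_pM2r //.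
apply: le_trans (ler_normB _ _) _; apply: le_trans K.
by rewrite mulr2n mulrDl mul1r lerD.
Qed.

(** Clairaut's theorem: the second difference is symmetric in v and w, so the two limits
    agree. *)
Lemma derive_comm D (F : 'rV[R]_m -> R) (x v w : 'rV[R]_m) : open D -> D x ->
  (forall y, D y -> differentiable F y) ->
  differentiable ('D_v F) x -> differentiable ('D_w F) x ->
  'D_w ('D_v F) x = 'D_v ('D_w F) x.
Proof.
move=> oD Dx dF dv dw; apply/eqP; rewrite -subr_eq0 -normr_eq0 -[_ == 0]negbK -normr_gt0 normr_id.
apply/negP => h; set n := `|_| in h.
have h3 : 0 < n / 3 by rewrite divr_gt0.
have [d1 d10 /(_ (Num.min d1 _ / 2)) H1] := second_difference w oD Dx dF dv h3.
have [d2 d20 /(_ (Num.min d1 d2 / 2)) H2] := second_difference v oD Dx dF dw h3.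
have {}H1 := H1 d2.
have m0 : 0 < Num.min d1 d2 by rewrite lt_min d10.
set s := Num.min d1 d2 / 2 in H1 H2.
have s0 : 0 < s by rewrite divr_gt0.
have sm : s < Num.min d1 d2 by rewrite ltr_pdivrMr // ltr_pMr // ltr1n.
move: H1 H2; rewrite s0 /=.
move=> /(_ (lt_le_trans sm _))/wrap[]; first by rewrite ge_min lexx.
move=> A1 /(_ (lt_le_trans sm _))/wrap[]; first by rewrite ge_min lexx orbT.
rewrite [x + s *: v + s *: w]addrAC => A2.
move: A1 A2 h; rewrite /n {h3 n}; move: ('D_w _ x) ('D_v _ x) => L1 L2.
move: (F (x + s *: w + s *: v)) (F (x + s *: w)) (F (x + s *: v)) (F x) => a b c f A1 A2 h.
have := le_trans (ler_normB _ _) (lerD A2 A1).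
have -> : a - b - c + f - s ^+ 2 * L2 - (a - c - b + f - s ^+ 2 * L1) = s ^+ 2 * (L1 - L2).
  by ring.
have s2 : 0 < s ^+ 2 by rewrite exprn_gt0.
rewrite normrM (ger0_norm (ltW s2)) -mulrDl [X in X <= _]mulrC ler_pM2r //.
by move: h; lra.
Qed.

End CkTheory.

(** * Smooth functions and vector fields on a manifold *)

Lemma Ck_sub (R : realType) m k (D D' : set 'rV[R]_m) f : D' `<=` D -> Ck k D f -> Ck k D' f.
Proof.
elim: k f => [|k IH] f DD /=; first by move=> cf x /DD; exact: cf.
by move=> [df cDf]; split=> [x /DD|v]; [exact: df|exact: IH].
Qed.

Lemma Cinfty_sub (R : realType) m (D D' : set 'rV[R]_m) f :
  D' `<=` D -> Cinfty D f -> Cinfty D' f.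
Proof. by move=> DD cf k; apply: Ck_sub (cf k). Qed.

Lemma Cinfty_sum (R : realType) m (D : set 'rV[R]_m) n (F : 'I_n -> 'rV[R]_m -> R) :
  open D -> (forall i, Cinfty D (F i)) -> Cinfty D (fun x => \sum_i F i x).
Proof.
move=> oD cF k; elim: n F cF => [|n IH] F cF.
  by under eq_fun do rewrite big_ord0; exact: Ck_cst.
under eq_fun do rewrite big_ord_recl.
by apply: Ck_add => //; [exact: cF|exact: IH].
Qed.

Section ManifoldCalculus.
Variables (R : realType) (m : nat) (M : smoothManifold R m).
Implicit Types (X Y : vfield M) (f g : M -> R) (p q : M) (U : set M).

Local Notation dm p := (dom (chart_at p)).
Local Notation fw p := (fwd (chart_at p)).
Local Notation bw p := (bwd (chart_at p)).

Lemma img_near p U q : open U -> U q -> dm p q -> \forall y \near fw p q, U (bw p y).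
Proof.
move=> oU Uq pq.
have c : {for fw p q, continuous (bw p)} by apply: bwd_continuous; exists q.
apply: c; rewrite fwdK //; exact: open_nbhs_nbhs.
Qed.

Lemma img_near_dom p q : dm p q -> \forall y \near fw p q, (fw p @` dm p) y.
Proof. by move=> pq; apply: open_nbhs_nbhs; split; [exact: img_open|exists q]. Qed.

Lemma img_openI p U : open U -> open (fw p @` (dm p `&` U)).
Proof.
move=> oU; rewrite openE => _ [q [pq Uq] <-]; rewrite /interior.
near=> y.
have [q' pq' qy] : (fw p @` dm p) y by near: y; exact: img_near_dom.
exists q' => //; split => //; rewrite -(fwdK pq') qy; near: y; exact: img_near.
Unshelve. all: by end_near. Qed.

Lemma smooth_on_ext U f g : open U -> (forall p, U p -> f p = g p) ->
  smooth_on U f -> smooth_on U g.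
Proof.
move=> oU fg sf p; apply: Cinfty_ext (sf p); first exact: img_openI.
by move=> _ [q [pq Uq] <-] /=; rewrite fwdK // fg.
Qed.

Lemma smooth_on_sub U V f : V `<=` U -> smooth_on U f -> smooth_on V f.
Proof.
move=> VU sf p; apply: Cinfty_sub (sf p).
by move=> _ [q [pq Vq] <-]; exists q => //; split => //; exact: VU.
Qed.

Lemma smooth_onD U f g : open U -> smooth_on U f -> smooth_on U g ->
  smooth_on U (fun p => f p + g p).
Proof. by move=> oU sf sg p k; apply: Ck_add; [exact: img_openI|exact: sf|exact: sg]. Qed.

Lemma smooth_onM U f g : open U -> smooth_on U f -> smooth_on U g ->
  smooth_on U (fun p => f p * g p).
Proof. by move=> oU sf sg p; apply: Cinfty_mul; [exact: img_openI|exact: sf|exact: sg]. Qed.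

Lemma smooth_cst (c : R) : smooth (fun _ : M => c).
Proof. by move=> p k; exact: Ck_cst. Qed.

Lemma smoothD f g : smooth f -> smooth g -> smooth (fun p => f p + g p).
Proof. by move=> sf sg; apply: smooth_onD => //; exact: openT. Qed.

Lemma smoothM f g : smooth f -> smooth g -> smooth (fun p => f p * g p).
Proof. by move=> sf sg; apply: smooth_onM => //; exact: openT. Qed.

Lemma smooth_on_diff U f p q : smooth_on U f -> U q -> dm p q ->
  differentiable (f \o bw p) (fw p q).
Proof. by move=> sf Uq pq; have [df _] := CinftyP (sf p); apply: df; exists q. Qed.

Lemma smooth_diff f p : smooth f -> differentiable (f \o bw p) (fw p p).
Proof. by move=> sf; apply: smooth_on_diff sf _ _ => //; exact: mem_chart_at. Qed.

Lemma coordf_smooth q i : smooth_on (dm q) (coordf q i).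
Proof. by move=> p; exact: transition_smooth. Qed.

Lemma vapp_addl U X Y f p : smooth_on U f -> U p ->
  vapp (X \+ Y) f p = vapp X f p + vapp Y f p.
Proof.
move=> sf Up; have df := smooth_on_diff sf Up (mem_chart_at p).
by rewrite /vapp !deriveE // linearD.
Qed.

Lemma vapp_scalel U (u : M -> R) X f p : smooth_on U f -> U p ->
  vapp (vscale u X) f p = u p * vapp X f p.
Proof.
move=> sf Up; have df := smooth_on_diff sf Up (mem_chart_at p).
by rewrite /vapp !deriveE // linearZ.
Qed.

Lemma vappD X f g p : smooth f -> smooth g ->
  vapp X (fun q => f q + g q) p = vapp X f p + vapp X g p.
Proof.
move=> sf sg; rewrite /vapp.
by rewrite -(deriveD (f := f \o bw p) (g := g \o bw p)) //;
  apply: diff_derivable; exact: smooth_diff.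
Qed.

Lemma vappM X f g p : smooth f -> smooth g ->
  vapp X (fun q => f q * g q) p = f p * vapp X g p + vapp X f p * g p.
Proof.
move=> sf sg.
rewrite [LHS](@deriveM _ _ (f \o bw p) (g \o bw p)); last 2 first.
- by apply: diff_derivable; exact: smooth_diff.
- by apply: diff_derivable; exact: smooth_diff.
rewrite /GRing.scale /= fwdK; last exact: mem_chart_at.
by congr (_ + _); rewrite mulrC.
Qed.

Lemma vapp_cst X (c : R) p : vapp X (fun=> c) p = 0.
Proof. exact: derive_cst. Qed.

Lemma derive_delta (F : 'rV[R]_m -> R) x v : differentiable F x ->
  'D_v F x = \sum_i v ord0 i * 'D_(delta_mx ord0 i) F x.
Proof.
move=> dF; rewrite deriveE // {1}(row_sum_delta v) linear_sum.
by apply: eq_bigr => i _; rewrite linearZ /= -deriveE.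
Qed.

(** The chain rule for the change from the chart at q, which defines vapp at q, to a fixed
    chart at p: near p, vapp Y f becomes an honest function of the coordinates. *)
Lemma vapp_local U Y f p q : open U -> smooth_on U f -> U q -> dm p q ->
  vapp Y f q = \sum_i vapp Y (coordf p i) q * 'D_(delta_mx ord0 i) (f \o bw p) (fw p q).
Proof.
move=> oU sf Uq pq; have qq := mem_chart_at q.
pose T i := coordf p i \o bw q.
have dT i : differentiable (T i) (fw q q).
  exact: smooth_on_diff (@coordf_smooth p i) pq qq.
pose T' := \sum_i (fun y => T i y *: (delta_mx ord0 i : 'rV[R]_m)).
have T'E y : T' y = fw p (bw q y).
  by rewrite /T' fct_sumE [RHS]row_sum_delta.
have dT' : differentiable T' (fw q q).
  by apply: differentiable_sum => i; exact: differentiableZl.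
have T'q : T' (fw q q) = fw p q by rewrite T'E fwdK.
have dF : differentiable (f \o bw p) (T' (fw q q)).
  by rewrite T'q; exact: smooth_on_diff sf Uq pq.
rewrite [LHS](_ : _ = 'D_(Y q) ((f \o bw p) \o T') (fw q q)); last first.
  apply: near_eq_derive; near=> y; rewrite /= T'E fwdK //.
  by near: y; apply: img_near => //; exact: dom_open.
rewrite deriveE; last exact: differentiable_comp.
rewrite diff_comp // [LHS]/= -deriveE // T'q.
rewrite derive_delta; last by rewrite -T'q.
apply: eq_bigr => i _; congr (_ * _).
rewrite -deriveE // derive_mx; last exact: diff_derivable.
rewrite mxE; suff -> : (fun y => T' y ord0 i) = T i by [].
by apply/funext => y; rewrite T'E.
Unshelve. all: by end_near. Qed.

Lemma vapp_smooth_on U X f : open U -> smooth_vf X -> smooth_on U f ->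
  smooth_on U (vapp X f).
Proof.
move=> oU sX sf p.
apply: (@Cinfty_ext _ _ _ (fun y => \sum_i (vapp X (coordf p i) (bw p y) *
   'D_(delta_mx ord0 i) (f \o bw p) y))); first exact: img_openI.
  by move=> _ [q [pq Uq] <-] /=; rewrite fwdK // (vapp_local _ oU sf Uq pq).
apply: Cinfty_sum; first exact: img_openI.
move=> i; apply: Cinfty_mul; first exact: img_openI.
  apply: Cinfty_sub (sX p i p) => _ [q [pq Uq] <-]; by exists q.
by have [_] := CinftyP (sf p); apply.
Qed.

Lemma vapp_smooth X f : smooth_vf X -> smooth f -> smooth (vapp X f).
Proof. by move=> sX sf; apply: vapp_smooth_on => //; exact: openT. Qed.

Lemma smooth_vfD X Y : smooth_vf X -> smooth_vf Y -> smooth_vf (X \+ Y).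
Proof.
move=> sX sY q i; apply: smooth_on_ext (smooth_onD _ (sX q i) (sY q i)); try exact: dom_open.
by move=> p qp; rewrite (vapp_addl _ _ (@coordf_smooth q i) qp).
Qed.

Lemma smooth_vfZ (u : M -> R) X : smooth u -> smooth_vf X -> smooth_vf (vscale u X).
Proof.
move=> su sX q i; have oq := dom_open (chart_at q).
apply: smooth_on_ext (smooth_onM oq (smooth_on_sub _ su) (sX q i)) => //.
by move=> p qp; rewrite (vapp_scalel _ _ (@coordf_smooth q i) qp).
Qed.

Lemma vapp_coordf X p i : vapp X (coordf p i) p = X p ord0 i.
Proof.
rewrite /vapp [LHS](_ : _ = 'D_(X p) (fun y : 'rV[R]_m => y ord0 i) (fw p p)).
  have h : derivable (@id 'rV[R]_m) (fw p p) (X p) by exact: derivable_id.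
  have := derive_mx h.
  by rewrite derive_id => /matrixP/(_ ord0 i); rewrite mxE => ->.
apply: near_eq_derive; near=> y.
have [q pq <-] : (fw p @` dm p) y by near: y; apply: img_near_dom; exact: mem_chart_at.
by rewrite /= /coordf fwdK.
Unshelve. all: by end_near. Qed.

(** In the chart at p, X (Y f) is the sum over i of X (Y x^i) d_i f plus the Hessian term
    D_(Y p) (D_(X p) f); the latter is symmetric in X and Y. *)
Lemma vapp_bracket X Y f p : smooth_vf X -> smooth_vf Y -> smooth f ->
  vapp (bracket X Y) f p = vapp X (vapp Y f) p - vapp Y (vapp X f) p.
Proof.
move=> sX sY sf; have pp := mem_chart_at p.
pose F := f \o bw p; pose x := fw p p; pose D := fw p @` (dm p `&` setT).
have oD : open D by apply: img_openI; exact: openT.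
have Dx : D x by exists p.
have cF : Cinfty D F by exact: sf.
have [dF cDF] := CinftyP cF.
have ddF v : differentiable ('D_v F) x by have [h _] := CinftyP (cDF v); exact: h.
have second Z Z' : smooth_vf Z -> smooth_vf Z' -> vapp Z (vapp Z' f) p =
    \sum_i (vapp Z (vapp Z' (coordf p i)) p * 'D_(delta_mx ord0 i) F x)
    + 'D_(Z' p) ('D_(Z p) F) x.
  move=> sZ sZ'.
  pose G i := vapp Z' (coordf p i) \o bw p.
  have dG i : differentiable (G i) x.
    exact: (smooth_on_diff (sZ' p i) pp pp).
  have -> : vapp Z (vapp Z' f) p =
    'D_(Z p) (\sum_i (G i * 'D_(delta_mx ord0 i) F)) x.
    apply: near_eq_derive; near=> y.
    have [q pq <-] : (fw p @` dm p) y by near: y; exact: img_near_dom.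
    rewrite fct_sumE /= fwdK // (vapp_local _ openT sf _ pq) //.
    by apply: eq_bigr => i _; rewrite !fctE /G /= fwdK.
  rewrite derive_sum; last by move=> i; apply: derivableM; exact: diff_derivable.
  rewrite [X in _ + X]derive_delta // -big_split; apply: eq_bigr => i _ /=.
  rewrite deriveM; try exact: diff_derivable.
  rewrite addrC /GRing.scale /= (derive_comm oD Dx dF (ddF _) (ddF _)).
  have -> : 'D_(Z p) (G i) x = vapp Z (vapp Z' (coordf p i)) p by [].
  have -> : G i x = Z' p ord0 i by rewrite /G /= fwdK // vapp_coordf.
  by rewrite [X in _ = _ + X]mulrC.
have sub (a b c d : R) : c = d -> a + c - (b + d) = a - b by move=> ->; ring.
rewrite (second X Y) // (second Y X) // sub; last first.
  exact: (derive_comm oD Dx dF (ddF _) (ddF _)).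
rewrite -sumrB [LHS](derive_delta _ (dF x Dx)).
by apply: eq_bigr => i _; rewrite mxE mulrBl.
Unshelve. all: by end_near. Qed.

End ManifoldCalculus.

(** * Metric algebra of a contact metric manifold *)

(** From here on the metric, phi, h, the curvature and the derivative of functions are
    used as symbols subject to identities; sealing them keeps their coordinate
    expressions out of the computations. *)
HB.lock Definition inner (R : realType) n (M : contactMetricManifold R n)
  (X Y : vfield M) : M -> R := ev02 (cm_g M) X Y.

HB.lock Definition rot (R : realType) n (M : contactMetricManifold R n)
  (X : vfield M) : vfield M := ev11 (cm_phi M) X.

HB.lock Definition hten (R : realType) n (M : contactMetricManifold R n)
  (X : vfield M) : vfield M := cm_h X.

HB.lock Definition Rm (R : realType) n (M : contactMetricManifold R n)
  (D : connection M) (X Y Z : vfield M) : vfield M := curv D X Y Z.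

HB.lock Definition dir (R : realType) n (M : contactMetricManifold R n)
  (X : vfield M) (f : M -> R) : M -> R := vapp X f.

Section MetricAlgebra.
Variables (R : realType) (n : nat) (M : contactMetricManifold R n).
Implicit Types (X Y Z V : vfield M) (p : M) (u : M -> R).

Local Notation ip := (@inner _ _ M).
Local Notation phi := (@rot _ _ M).
Local Notation xi := (cm_xi M).

Lemma ipE X Y p : ip X Y p = (X p *m cm_g M p *m (Y p)^T) ord0 ord0.
Proof. by rewrite inner.unlock. Qed.

Lemma rotE X p : phi X p = X p *m cm_phi M p.
Proof. by rewrite rot.unlock. Qed.

Lemma ipC X Y p : ip X Y p = ip Y X p.
Proof.
have [_ gT _] := cm_g_riemannian M.
rewrite !ipE; have -> : X p *m cm_g M p *m (Y p)^T = (Y p *m cm_g M p *m (X p)^T)^T.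
  by rewrite !trmx_mul trmxK gT mulmxA.
by rewrite mxE.
Qed.

Lemma ipDl X Y Z p : ip (X \+ Y) Z p = ip X Z p + ip Y Z p.
Proof. by rewrite !ipE !mulmxDl mxE. Qed.

Lemma ipZl u X Z p : ip (vscale u X) Z p = u p * ip X Z p.
Proof. by rewrite !ipE /vscale -!scalemxAl mxE. Qed.

Lemma ipBl X Y Z p : ip (X \- Y) Z p = ip X Z p - ip Y Z p.
Proof. by rewrite !ipE !mulmxBl !mxE. Qed.

Lemma ipDr X Y Z p : ip Z (X \+ Y) p = ip Z X p + ip Z Y p.
Proof. by rewrite ipC ipDl !(ipC Z). Qed.

Lemma ipZr u X Z p : ip Z (vscale u X) p = u p * ip Z X p.
Proof. by rewrite ipC ipZl (ipC Z). Qed.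

Lemma ip_eq0 X p : ip X X p = 0 -> X p = 0.
Proof.
have [_ _ g0] := cm_g_riemannian M.
by move=> e; apply/eqP/negPn/negP => /(g0 p); rewrite -[X in 0 < X]ipE e ltxx.
Qed.

Lemma ip_ge0 X p : 0 <= ip X X p.
Proof.
have [_ _ g0] := cm_g_riemannian M.
rewrite ipE; have [X0|/(g0 p)/ltW //] := eqVneq (X p) 0.
by rewrite X0 !mul0mx mxE.
Qed.

Lemma ip_nondeg X p : (forall Y, smooth_vf Y -> ip X Y p = 0) -> smooth_vf X -> X p = 0.
Proof. by move=> h sX; apply: ip_eq0; exact: h. Qed.

Lemma phiD X Y : phi (X \+ Y) = phi X \+ phi Y.
Proof. by apply/funext => p; rewrite /= !rotE mulmxDl. Qed.

Lemma phiZ u X : phi (vscale u X) = vscale u (phi X).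
Proof. by apply/funext => p; rewrite rotE /vscale rotE -scalemxAl. Qed.

Lemma phiB X Y : phi (X \- Y) = phi X \- phi Y.
Proof. by apply/funext => p; rewrite /= !rotE mulmxBl. Qed.

Lemma smooth_phi X : smooth_vf X -> smooth_vf (phi X).
Proof. by rewrite rot.unlock; exact: cm_phi_smooth. Qed.

Lemma phi2_eta X p : smooth_vf X ->
  phi (phi X) p = - X p + ev1 (cm_eta M) X p *: xi p.
Proof. by move=> sX; rewrite rot.unlock; exact: cm_phi2. Qed.

(** phi^2 xi = 0 makes phi xi a multiple c xi, and then 0 = phi^2 xi = c^2 xi. *)
Lemma phi_xi p : phi xi p = 0.
Proof.
have sx := @cm_xi_smooth R n M.
have px2 : phi (phi xi) p = 0 by rewrite phi2_eta // cm_eta_xi scale1r addNr.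
have px3 : phi xi p = ev1 (cm_eta M) (phi xi) p *: xi p.
  have := phi2_eta p (smooth_phi sx).
  rewrite rotE px2 mul0mx => /esym/eqP; rewrite addrC subr_eq0 => /eqP ->.
  by [].
have : ev1 (cm_eta M) (phi xi) p *: phi xi p = 0.
  by rewrite -px2 [RHS]rotE [in RHS]px3 -scalemxAl -rotE.
by move/eqP; rewrite scaler_eq0 => /orP[/eqP e|/eqP //]; rewrite px3 e scale0r.
Qed.

(** Compare phi (phi^2 X) with phi^2 (phi X). *)
Lemma eta_phi X p : smooth_vf X -> ev1 (cm_eta M) (phi X) p = 0.
Proof.
move=> sX; have := phi2_eta p (smooth_phi sX).
have xi0 : xi p != 0.
  apply/eqP => e; have := @cm_eta_xi _ _ M p.
  by rewrite /ev1 e mul0mx mxE => /eqP; rewrite eq_sym oner_eq0.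
rewrite rotE phi2_eta // mulmxDl -scalemxAl mulNmx -!rotE phi_xi scaler0 addr0.
move=> /eqP; rewrite -subr_eq0 opprD addrA subrr sub0r oppr_eq0 scaler_eq0 (negPf xi0) orbF.
by move/eqP.
Qed.

Lemma ip_compat X Y p : smooth_vf X -> smooth_vf Y ->
  ip (phi X) (phi Y) p = ip X Y p - ev1 (cm_eta M) X p * ev1 (cm_eta M) Y p.
Proof. by move=> sX sY; rewrite inner.unlock rot.unlock; exact: cm_compat. Qed.

Lemma eta_ip X p : smooth_vf X -> ev1 (cm_eta M) X p = ip X xi p.
Proof.
move=> sX; have := ip_compat p sX (@cm_xi_smooth R n M).
rewrite cm_eta_xi mulr1 ipE phi_xi trmx0 mulmx0 mxE => /esym/eqP.
by rewrite subr_eq0 => /eqP.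
Qed.

Lemma ip_phi2 X Y p : smooth_vf X -> smooth_vf Y ->
  ip (phi X) (phi Y) p = ip X Y p - ip X xi p * ip Y xi p.
Proof. by move=> sX sY; rewrite ip_compat // !eta_ip. Qed.

Lemma ip_xi_xi p : ip xi xi p = 1.
Proof. by rewrite -eta_ip ?cm_eta_xi //; exact: cm_xi_smooth. Qed.

Lemma ip_phi_xi X p : smooth_vf X -> ip (phi X) xi p = 0.
Proof. by move=> sX; rewrite -eta_ip ?eta_phi //; exact: smooth_phi. Qed.

Lemma phi2E X p : smooth_vf X -> phi (phi X) p = - X p + ip X xi p *: xi p.
Proof. by move=> sX; rewrite phi2_eta // eta_ip. Qed.

Lemma ip_phi_skew X Y p : smooth_vf X -> smooth_vf Y ->
  ip (phi X) Y p = - ip X (phi Y) p.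
Proof.
move=> sX sY; have := @ip_phi2 X (phi Y) p sX (smooth_phi sY).
rewrite ip_phi_xi // mulr0 subr0 => <-.
have -> : ip (phi X) (phi (phi Y)) p =
  ip (phi X) (vscale (fun=> -1) Y \+ vscale (ip Y xi) xi) p.
  by rewrite [LHS]ipE [RHS]ipE phi2E //= /vscale scaleN1r.
by rewrite ipDr !ipZr ip_phi_xi // mulr0 addr0 mulN1r opprK.
Qed.

Lemma ip_phi_self X p : smooth_vf X -> ip X (phi X) p = 0.
Proof.
by move=> sX; have := @ip_phi_skew X X p sX sX; rewrite ipC; lra.
Qed.

Lemma horizontal_phi X : smooth_vf X -> horizontal (phi X).
Proof.
move=> sX; split; [exact: smooth_phi|move=> p].
by have := ip_phi_xi p sX; rewrite inner.unlock.
Qed.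

Lemma horizontal_ip X p : horizontal X -> ip X xi p = 0.
Proof. by case=> _ /(_ p); rewrite inner.unlock. Qed.

Lemma horizontal_phi2 X : horizontal X -> phi (phi X) = vscale (fun=> -1) X.
Proof.
move=> hX; apply/funext => p.
by rewrite phi2E ?(horizontal_ip _ hX) ?scale0r ?addr0 /vscale ?scaleN1r //; case: hX.
Qed.

Lemma deta_ip X Y p : smooth_vf X -> smooth_vf Y ->
  dform (cm_eta M) X Y p = ip X (phi Y) p.
Proof. by move=> sX sY; rewrite cm_deta // inner.unlock rot.unlock. Qed.

Lemma ip_zero_r X V p : ip X X p = 0 -> ip V X p = 0.
Proof. by move=> /ip_eq0 e; rewrite ipE e trmx0 mulmx0 mxE. Qed.

Lemma ip_zero_l X V p : X p = 0 -> ip X V p = 0.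
Proof. by move=> e; rewrite ipE e !mul0mx mxE. Qed.

Lemma ip_congl X X' V p : X p = X' p -> ip X V p = ip X' V p.
Proof. by move=> e; rewrite !ipE e. Qed.

Lemma ip_phi_phi X p : horizontal X -> ip (phi X) (phi X) p = ip X X p.
Proof.
by move=> hX; rewrite ip_phi2 ?(horizontal_ip _ hX) ?mul0r ?subr0 //; case: hX.
Qed.

End MetricAlgebra.

(** * Frames of a 3-dimensional contact metric manifold *)

Section Frame.
Variables (R : realType) (M : contactMetricManifold R 1).
Implicit Types (X Y Z V : vfield M) (p : M) (u : M -> R).

Local Notation ip := (@inner _ _ M).
Local Notation phi := (@rot _ _ M).
Local Notation xi := (cm_xi M).

(** If phi X_i vanished at p for every i, then so would all values d eta (X_i, X_j) =
    <X_i, phi X_j> and with them the contact volume. *)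
Lemma exists_horizontal p : exists2 X : vfield M, horizontal X & 0 < ip X X p.
Proof.
have [X [sX volX]] := @cm_eta_contact _ _ M p.
have [i Xi] : exists i, phi (X i) p != 0.
  apply: contrapT => /forallNP h; move/eqP: volX; apply.
  apply: big1 => s _; rewrite big_ord1 deta_ip //.
  set Y := phi _; have -> : ip (X (s (inord 1))) Y p = 0.
    rewrite ipE (_ : Y p = 0) ?trmx0 ?mulmx0 ?mxE //.
    by apply/eqP/negPn/negP; exact: h.
  by rewrite mulr0.
exists (phi (X i)); first exact: horizontal_phi.
rewrite lt_def ip_ge0 andbT; apply: contra Xi => /eqP e.
by rewrite (ip_eq0 e).
Qed.

(** X, phi X, xi are orthogonal of squared norms |X|^2, |X|^2, 1, so where X <> 0 their Gram
    matrix is invertible and the difference of the two sides, being orthogonal to all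
    three, vanishes; where X = 0 both sides do. *)
Lemma frame_expand X V p : horizontal X ->
  ip X X p *: V p = ip V X p *: X p + ip V (phi X) p *: phi X p
     + (ip X X p * ip V xi p) *: xi p.
Proof.
move=> hX; have [sX _] := hX; have X0 := horizontal_ip p hX.
have [Xp0|f0] := eqVneq (ip X X p) 0.
  have Xp : X p = 0 by exact: ip_eq0.
  by rewrite Xp0 [phi X p]rotE Xp mul0mx !scaler0 mul0r !scale0r !addr0.
pose b (i : 'I_3) : vfield M := tnth [tuple X; phi X; xi] i.
pose d (i : 'I_3) : R := tnth [tuple ip X X p; ip X X p; 1] i.
pose B : 'M[R]_3 := \matrix_(i, j) (b i p ord0 j).
have rB i : row i B = b i p by apply/rowP => j; rewrite !mxE.
have orth i j : ip (b i) (b j) p = if i == j then d i else 0.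
  have yy := ip_phi_phi p hX.
  case: i => [[|[|[|//]]] hi]; case: j => [[|[|[|//]]] hj];
    rewrite /b /d !(tnth_nth xi) ?(tnth_nth 0) /=.
  - by [].
  - exact: ip_phi_self.
  - exact: X0.
  - by rewrite ipC ip_phi_self.
  - by [].
  - exact: ip_phi_xi.
  - by rewrite ipC.
  - by rewrite ipC ip_phi_xi.
  - exact: ip_xi_xi.
have BGB : B *m (cm_g M p *m B^T) = diag_mx (\row_i d i).
  apply/matrixP => i j; rewrite mulmxA.
  have -> : (B *m cm_g M p *m B^T) i j = ip (b i) (b j) p.
    by rewrite ipE -!rB -row_mul [LHS]mxE [RHS]mxE; apply: eq_bigr => k _; rewrite !mxE.
  by rewrite orth !mxE; case: eqP.
have uG : cm_g M p *m B^T \in unitmx.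
  have : B *m (cm_g M p *m B^T) \in unitmx.
    rewrite BGB unitmxE det_diag unitfE !big_ord_recl big_ord0 !mxE /d !(tnth_nth 0) /=.
    by rewrite !mulr1 mulf_neq0.
  by rewrite unitmx_mul => /andP[].
pose cs (c : R) (Z : vfield M) := vscale (fun=> c) Z.
pose N := cs (ip X X p) V \- (cs (ip V X p) X \+ cs (ip V (phi X) p) (phi X)
     \+ cs (ip X X p * ip V xi p) xi).
apply/eqP; rewrite -subr_eq0; apply/eqP; rewrite -/(N p).
have NGB : N p *m (cm_g M p *m B^T) = 0.
  apply/rowP => i; rewrite mulmxA.
  have -> : (N p *m cm_g M p *m B^T) ord0 i = ip N (b i) p.
    by rewrite ipE -rB [LHS]mxE [RHS]mxE; apply: eq_bigr => k _; rewrite !mxE.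
  rewrite [RHS]mxE.
  have -> : ip N (b i) p = ip X X p * ip V (b i) p - (ip V X p * ip X (b i) p +
     ip V (phi X) p * ip (phi X) (b i) p + (ip X X p * ip V xi p) * ip xi (b i) p).
    by rewrite ipBl !ipDl !ipZl.
  have o0 : ip X (b i) p = _ := orth (Ordinal (isT : 0 < 3)%N) i.
  have o1 : ip (phi X) (b i) p = _ := orth (Ordinal (isT : 1 < 3)%N) i.
  have o2 : ip xi (b i) p = _ := orth (Ordinal (isT : 2 < 3)%N) i.
  rewrite o0 o1 o2 {o0 o1 o2}.
  case: i => [[|[|[|//]]] hi]; rewrite /b /d !(tnth_nth xi) ?(tnth_nth 0) /=; ring.
by rewrite -[LHS](mulmxK uG) NGB mul0mx.
Qed.

End Frame.

(** * The Levi-Civita connection *)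

Section Smoothness.
Variables (R : realType) (n : nat) (M : contactMetricManifold R n) (D : connection M).
Hypothesis lcD : levi_civita (cm_g M) D.
Implicit Types (X Y Z V W : vfield M) (p : M) (u : M -> R).

Local Notation ip := (@inner _ _ M).
Local Notation phi := (@rot _ _ M).
Local Notation xi := (cm_xi M).

Lemma smooth_ip X Y : smooth_vf X -> smooth_vf Y -> smooth (ip X Y).
Proof. by have [h _ _] := cm_g_riemannian M; rewrite inner.unlock; exact: h. Qed.

Lemma smooth_D X Y : smooth_vf X -> smooth_vf Y -> smooth_vf (D X Y).
Proof. by case: lcD => h _; exact: h. Qed.

Lemma smooth_xi : smooth_vf xi.
Proof. exact: cm_xi_smooth. Qed.

Lemma sub_vf X Y : X \- Y = X \+ vscale (fun=> -1) Y.
Proof. by apply/funext => p; rewrite /vscale /= scaleN1r. Qed.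

Lemma smooth_vfB X Y : smooth_vf X -> smooth_vf Y -> smooth_vf (X \- Y).
Proof.
move=> sX sY; rewrite sub_vf.
exact: (smooth_vfD sX (smooth_vfZ (@smooth_cst _ _ _ _) sY)).
Qed.

Lemma bracketE X Y : smooth_vf X -> smooth_vf Y -> bracket X Y = D X Y \- D Y X.
Proof. by case: lcD => _ [_ [_ [_ [_ [h _]]]]] sX sY; rewrite h. Qed.

Lemma smooth_bracket X Y : smooth_vf X -> smooth_vf Y -> smooth_vf (bracket X Y).
Proof.
move=> sX sY; rewrite (bracketE sX sY).
exact: (smooth_vfB (smooth_D sX sY) (smooth_D sY sX)).
Qed.

Lemma smooth_Rm X Y Z : smooth_vf X -> smooth_vf Y -> smooth_vf Z ->
  smooth_vf (Rm D X Y Z).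
Proof.
move=> sX sY sZ; rewrite Rm.unlock; exact: (smooth_vfB (smooth_vfB (smooth_D sX (smooth_D sY sZ))
  (smooth_D sY (smooth_D sX sZ))) (smooth_D (smooth_bracket sX sY) sZ)).
Qed.

Lemma smooth_dir X u : smooth_vf X -> smooth u -> smooth (dir X u).
Proof. by move=> sX su; rewrite dir.unlock; exact: vapp_smooth. Qed.

End Smoothness.

(** The closure properties of smoothness, selected by the head symbol only. *)
Ltac smoothness :=
  match goal with
  | H : smooth_vf ?X |- smooth_vf ?X => exact H
  | H : smooth ?u |- smooth ?u => exact H
  | H : horizontal ?X |- smooth_vf ?X => exact (proj1 H)
  | |- smooth_vf (cm_xi ?M) => exact (@smooth_xi _ _ M)
  | |- smooth_vf (rot _) => apply: smooth_phi; smoothness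
  | |- smooth_vf (vscale _ _) => apply: smooth_vfZ; smoothness
  | |- smooth_vf (_ \+ _) => apply: smooth_vfD; smoothness
  | |- smooth_vf (_ \- _) => apply: smooth_vfB; smoothness
  | H : levi_civita _ ?D |- smooth_vf (?D _ _) => apply: (smooth_D H); smoothness
  | H : levi_civita _ ?D |- smooth_vf (bracket _ _) =>
      apply: (smooth_bracket H); smoothness
  | H : levi_civita _ ?D |- smooth_vf (Rm ?D _ _ _) =>
      apply: (smooth_Rm H); smoothness
  | |- smooth (inner _ _) => apply: smooth_ip; smoothness
  | |- smooth (dir _ _) => apply: smooth_dir; smoothness
  | |- smooth (fun _ => ?c) => exact: smooth_cst
  | |- smooth (fun p => ?u p) => change (smooth u); smoothness
  | |- smooth (fun p => @?f p + @?g p) => apply: (@smoothD _ _ _ f g); smoothness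
  | |- smooth (fun p => @?f p * @?g p) => apply: (@smoothM _ _ _ f g); smoothness
  end.

Ltac smooth_side :=
  try (lazymatch goal with |- smooth_vf _ => idtac | |- smooth _ => idtac end;
       solve [smoothness]).

Section Connection.
Variables (R : realType) (n : nat) (M : contactMetricManifold R n) (D : connection M).
Hypothesis lcD : levi_civita (cm_g M) D.
Implicit Types (X Y Z V W : vfield M) (p : M) (u : M -> R).

Local Notation ip := (@inner _ _ M).
Local Notation phi := (@rot _ _ M).
Local Notation xi := (cm_xi M).

Lemma dirD X u v p : smooth u -> smooth v ->
  dir X (fun q => u q + v q) p = dir X u p + dir X v p.
Proof. by rewrite dir.unlock; exact: vappD. Qed.

Lemma dirM X u v p : smooth u -> smooth v ->
  dir X (fun q => u q * v q) p = u p * dir X v p + dir X u p * v p.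
Proof. by rewrite dir.unlock; exact: vappM. Qed.

Lemma dir_cst X (c : R) p : dir X (fun=> c) p = 0.
Proof. by rewrite dir.unlock; exact: vapp_cst. Qed.

Lemma dirZ X (c : R) u p : smooth u -> dir X (fun q => c * u q) p = c * dir X u p.
Proof.
by move=> su; rewrite (dirM _ _ (@smooth_cst _ _ _ c) su) dir_cst mul0r addr0.
Qed.

Lemma dir_bracket X Y u p : smooth_vf X -> smooth_vf Y -> smooth u ->
  dir (bracket X Y) u p = dir X (dir Y u) p - dir Y (dir X u) p.
Proof. by rewrite dir.unlock; exact: vapp_bracket. Qed.

Lemma DDl X X' Y : smooth_vf X -> smooth_vf X' -> smooth_vf Y ->
  D (X \+ X') Y = D X Y \+ D X' Y.
Proof. by case: lcD => _ [h _]; exact: h. Qed.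

Lemma DZl u X Y : smooth u -> smooth_vf X -> smooth_vf Y ->
  D (vscale u X) Y = vscale u (D X Y).
Proof. by case: lcD => _ [_ [h _]]; exact: h. Qed.

Lemma DDr X Y Y' : smooth_vf X -> smooth_vf Y -> smooth_vf Y' ->
  D X (Y \+ Y') = D X Y \+ D X Y'.
Proof. by case: lcD => _ [_ [_ [h _]]]; exact: h. Qed.

Lemma DZr u X Y : smooth u -> smooth_vf X -> smooth_vf Y ->
  D X (vscale u Y) = vscale (dir X u) Y \+ vscale u (D X Y).
Proof. by rewrite dir.unlock; case: lcD => _ [_ [_ [_ [h _]]]]; exact: h. Qed.

Lemma dir_ip X Y Z p : smooth_vf X -> smooth_vf Y -> smooth_vf Z ->
  dir X (ip Y Z) p = ip (D X Y) Z p + ip Y (D X Z) p.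
Proof.
case: lcD => _ [_ [_ [_ [_ [_ h]]]]] sX sY sZ.
by rewrite dir.unlock inner.unlock (h X Y Z sX sY sZ).
Qed.

Lemma DBl X X' Y : smooth_vf X -> smooth_vf X' -> smooth_vf Y ->
  D (X \- X') Y = D X Y \- D X' Y.
Proof.
move=> sX sX' sY; rewrite !sub_vf DDl; smooth_side.
by rewrite DZl; smooth_side.
Qed.

Lemma ip_DD X Y Z V p : smooth_vf X -> smooth_vf Y -> smooth_vf Z -> smooth_vf V ->
  ip (D X (D Y Z)) V p = dir X (ip (D Y Z) V) p - ip (D Y Z) (D X V) p.
Proof. by move=> sX sY sZ sV; rewrite dir_ip; smooth_side; rewrite addrK. Qed.

(** Everything on the right is a derivative of a scalar product or a scalar product of
    first derivatives: no second covariant derivative is left. *)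
Lemma Rm_expand X Y Z V p :
  smooth_vf X -> smooth_vf Y -> smooth_vf Z -> smooth_vf V ->
  ip (Rm D X Y Z) V p =
  (dir X (ip (D Y Z) V) p - ip (D Y Z) (D X V) p)
  - (dir Y (ip (D X Z) V) p - ip (D X Z) (D Y V) p)
  - (ip (D (D X Y) Z) V p - ip (D (D Y X) Z) V p).
Proof.
move=> sX sY sZ sV; rewrite Rm.unlock /curv !ipBl !ip_DD; smooth_side.
by rewrite (bracketE lcD sX sY) DBl; smooth_side; rewrite ipBl.
Qed.

(** Expand ([X, Y] - X Y + Y X) <Z, V> = 0. *)
Lemma Rm_skew X Y Z V p :
  smooth_vf X -> smooth_vf Y -> smooth_vf Z -> smooth_vf V ->
  ip (Rm D X Y Z) V p = - ip (Rm D X Y V) Z p.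
Proof.
move=> sX sY sZ sV.
have vip W : smooth_vf W -> dir W (ip Z V) = (fun q => ip (D W Z) V q + ip (D W V) Z q).
  by move=> sW; apply/funext => q; rewrite dir_ip; smooth_side; rewrite (ipC Z).
have := dir_bracket p sX sY (smooth_ip sZ sV).
rewrite !vip; smooth_side.
rewrite !dirD; smooth_side.
rewrite Rm.unlock /curv !ipBl !ip_DD; smooth_side.
rewrite (ipC (D X V)) (ipC (D Y V)).
by move=> e; lra.
Qed.

(** |xi| = 1. *)
Lemma ip_Dxi_xi X p : smooth_vf X -> ip (D X xi) xi p = 0.
Proof.
move=> sX; have := dir_ip p sX (@smooth_xi _ _ M) (@smooth_xi _ _ M).
rewrite (_ : ip xi xi = fun=> 1); last by apply/funext => q; exact: ip_xi_xi.
by rewrite dir_cst (ipC xi) => e; lra.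
Qed.

(** This is 2 d eta, computed with the torsion-free connection. *)
Lemma Dxi_antisym X Y p : smooth_vf X -> smooth_vf Y ->
  ip (D X xi) Y p - ip (D Y xi) X p = 2 * ip X (phi Y) p.
Proof.
move=> sX sY; rewrite -deta_ip; smooth_side; rewrite /dform.
have eta Z : smooth_vf Z -> ev1 (cm_eta M) Z = ip Z xi.
  by move=> sZ; apply/funext => q; exact: eta_ip.
rewrite (bracketE lcD sX sY) !eta; smooth_side.
rewrite ipBl.
have vE (Z : vfield M) (u : M -> R) : vapp Z u p = dir Z u p by rewrite dir.unlock.
rewrite !vE !dir_ip; smooth_side; rewrite (ipC X) (ipC Y).
by field.
Qed.

(** The integral curves of xi are geodesics: xi spans the kernel of d eta. *)
Lemma D_xi_xi p : D xi xi p = 0.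
Proof.
apply: ip_nondeg; last by smoothness.
move=> Y sY; have := Dxi_antisym p (@smooth_xi _ _ M) sY.
by rewrite ip_Dxi_xi // (ipC xi) ip_phi_xi // => e; lra.
Qed.

Lemma Rm_xi X V p : smooth_vf X -> smooth_vf V ->
  ip (Rm D X xi xi) V p =
   - dir xi (ip (D X xi) V) p + ip (D X xi) (D xi V) p
   - ip (D (D X xi) xi) V p + ip (D (D xi X) xi) V p.
Proof.
move=> sX sV; rewrite Rm_expand; smooth_side.
have e0 W q : ip (D xi xi) W q = 0 by exact: ip_zero_l (D_xi_xi q).
rewrite (_ : ip (D xi xi) V = fun=> 0); last by apply/funext => q; exact: e0.
by rewrite dir_cst e0; ring.
Qed.

End Connection.

(** * The covariant derivative of the Reeb field in dimension 3 *)

Section ThreeDim.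
Variables (R : realType) (M : contactMetricManifold R 1) (D : connection M).
Hypothesis lcD : levi_civita (cm_g M) D.
Implicit Types (X Y Z V W U : vfield M) (p q : M) (u : M -> R).

Local Notation ip := (@inner _ _ M).
Local Notation phi := (@rot _ _ M).
Local Notation xi := (cm_xi M).

Lemma frame_field X V : horizontal X ->
  vscale (ip X X) V = vscale (ip V X) X \+ vscale (ip V (phi X)) (phi X)
    \+ vscale (fun q => ip X X q * ip V xi q) xi.
Proof. by move=> hX; apply/funext => q; exact: frame_expand. Qed.

Lemma ip_frame X U V p : horizontal X ->
  ip X X p * ip V U p = ip V X p * ip U X p + ip V (phi X) p * ip U (phi X) p
    + ip X X p * ip V xi p * ip U xi p.
Proof.
move=> hX; rewrite -(ipZl (ip X X)) frame_field // !ipDl !ipZl.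
by rewrite !(ipC U).
Qed.

Lemma D_frame X V Z U p : horizontal X -> smooth_vf V -> smooth_vf Z ->
  ip X X p * ip (D V Z) U p = ip V X p * ip (D X Z) U p
    + ip V (phi X) p * ip (D (phi X) Z) U p
    + ip X X p * ip V xi p * ip (D xi Z) U p.
Proof.
move=> hX sV sZ; rewrite -(ipZl (ip X X)) -(DZl lcD); smooth_side.
rewrite frame_field // !(DDl lcD); smooth_side.
by rewrite !(DZl lcD); smooth_side; rewrite !ipDl !ipZl.
Qed.

Lemma dir_ip0 X Y V p : smooth_vf X -> smooth_vf Y -> smooth_vf V ->
  (forall q, ip X Y q = 0) -> ip (D V X) Y p = - ip (D V Y) X p.
Proof.
move=> sX sY sV e; have := dir_ip lcD p sV sX sY.
by rewrite (_ : ip X Y = fun=> 0) ?dir_cst ?(ipC X); [lra|exact/funext].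
Qed.

Lemma D_norm X V p : smooth_vf X -> smooth_vf V ->
  ip (D V X) X p = dir V (ip X X) p / 2.
Proof. by move=> sX sV; rewrite (dir_ip lcD) // (ipC X); field. Qed.

Lemma D_norm_phi X V p : horizontal X -> smooth_vf V ->
  ip (D V (phi X)) (phi X) p = dir V (ip X X) p / 2.
Proof.
move=> hX sV; rewrite D_norm; smooth_side.
suff -> : ip (phi X) (phi X) = ip X X by [].
by apply/funext => q; exact: ip_phi_phi.
Qed.

(** (D_xi phi) Z. *)
Let J Z : vfield M := D xi (phi Z) \- phi (D xi Z).

Lemma J_add Z Z' p : smooth_vf Z -> smooth_vf Z' -> J (Z \+ Z') p = J Z p + J Z' p.
Proof.
move=> sZ sZ'; rewrite /J phiD !(DDr lcD); smooth_side.
by rewrite phiD /= opprD addrACA.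
Qed.

Lemma J_scale u Z p : smooth u -> smooth_vf Z -> J (vscale u Z) p = u p *: J Z p.
Proof.
move=> su sZ; rewrite /J phiZ !(DZr lcD); smooth_side.
by rewrite phiD !phiZ /vscale /= opprD addrACA subrr add0r scalerBr.
Qed.

(** J X is orthogonal to X, phi X and xi because differentiating <X, phi X> = 0,
    |phi X|^2 = |X|^2 and <phi X, xi> = 0 along xi leaves no other terms. *)
Lemma J_horizontal X p : horizontal X -> ip X X p != 0 -> J X p = 0.
Proof.
move=> hX f0; have sX := proj1 hX; have sx := @smooth_xi _ _ M.
have JX : ip (J X) X p = 0.
  rewrite /J ipBl ip_phi_skew; smooth_side.
  rewrite dir_ip0; smooth_side; first by rewrite opprK addNr.
  by move=> q; rewrite ipC ip_phi_self.
have JY : ip (J X) (phi X) p = 0.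
  rewrite /J ipBl ip_phi2; smooth_side.
  by rewrite D_norm_phi // D_norm // (horizontal_ip _ hX) mulr0 subr0 subrr.
have Jxi : ip (J X) xi p = 0.
  rewrite /J ipBl ip_phi_xi; smooth_side.
  rewrite dir_ip0; smooth_side; last by move=> q; rewrite ip_phi_xi.
  by rewrite (ip_zero_l _ (D_xi_xi lcD p)) oppr0 addr0.
apply: ip_eq0; apply: (mulfI f0).
by rewrite (ip_frame _ _ _ hX) JX JY Jxi !(mulr0, mul0r, addr0).
Qed.

(** D_xi phi = 0.  In dimension 3 this holds for every contact metric structure: phi is
    the rotation by a right angle of the contact planes, which D_xi preserves. *)
Lemma D_xi_phi X p : smooth_vf X -> D xi (phi X) p = phi (D xi X) p.
Proof.
move=> sX; have [X0 hX0 f0] := exists_horizontal p.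
have sX0 := proj1 hX0.
apply/eqP; rewrite -subr_eq0 -/(J X p).
have Jxi : J xi p = 0.
  have e : phi xi = vscale (fun=> 0) xi.
    by apply/funext => q; rewrite phi_xi /vscale scale0r.
  rewrite /J /= e (DZr lcD); smooth_side.
  by rewrite /= /vscale dir_cst !scale0r rotE (D_xi_xi lcD) mul0mx addr0 subr0.
have : J (vscale (ip X0 X0) X) p = 0.
  rewrite (frame_field X hX0) !J_add; smooth_side.
  rewrite !J_scale; smooth_side.
  have f1 : ip X0 X0 p != 0 by rewrite gt_eqF.
  rewrite Jxi (J_horizontal hX0 f1) (J_horizontal (horizontal_phi sX0)).
    by rewrite !scaler0 !addr0.
  by rewrite ip_phi_phi.
rewrite J_scale; smooth_side.
by move/eqP; rewrite scaler_eq0 gt_eqF.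
Qed.

(** The terms with D_xi in the Lie derivative cancel by D_xi phi = 0. *)
Lemma htenE X p : smooth_vf X ->
  hten X p = 2^-1 *: (phi (D X xi) p - D (phi X) xi p).
Proof.
move=> sX; have sphi : ev11 (cm_phi M) = @rot _ _ M by rewrite rot.unlock.
rewrite hten.unlock /cm_h /lie11 sphi !(bracketE lcD); smooth_side.
rewrite phiB /= D_xi_phi //; congr (_ *: _).
by rewrite opprB addrC subrKA.
Qed.

Lemma ip_h X V p : smooth_vf X -> smooth_vf V ->
  ip (hten X) V p = (ip (phi (D X xi)) V p - ip (D (phi X) xi) V p) / 2.
Proof.
by move=> sX sV; rewrite !ipE (htenE _ sX) -scalemxAl mulmxBl -scalemxAl mulmxBl !mxE mulrC.
Qed.

Lemma Dxi_off X p : horizontal X ->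
  ip (D X xi) (phi X) p - ip (D (phi X) xi) X p = - 2 * ip X X p.
Proof.
move=> hX; rewrite (Dxi_antisym lcD); smooth_side.
by rewrite (horizontal_phi2 hX) ipZr; ring.
Qed.

Variables kappa mu : R.
Hypothesis km : kappa_mu D kappa mu.

Lemma ip_kappa_mu X Y V p : smooth_vf X -> smooth_vf Y ->
  ip (Rm D X Y xi) V p =
    kappa * (ip Y xi p * ip X V p - ip X xi p * ip Y V p)
    + mu * (ip Y xi p * ip (hten X) V p - ip X xi p * ip (hten Y) V p).
Proof.
move=> sX sY; have e := km p sX sY.
rewrite (eta_ip p sX) (eta_ip p sY) in e.
pose cs (c : R) (Z : vfield M) := vscale (fun=> c) Z.
have -> : ip (Rm D X Y xi) V p =
  ip (cs kappa (cs (ip Y xi p) X \- cs (ip X xi p) Y) \+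
      cs mu (cs (ip Y xi p) (hten X) \- cs (ip X xi p) (hten Y))) V p.
  by apply: ip_congl; rewrite Rm.unlock e hten.unlock.
by rewrite ipDl !ipZl !ipBl !ipZl.
Qed.

Lemma Rm_xi_km U V p : horizontal U ->
  ip (Rm D U xi xi) V p = kappa * ip U V p + mu * ip (hten U) V p.
Proof.
move=> hU; rewrite ip_kappa_mu; smooth_side.
by rewrite ip_xi_xi (horizontal_ip p hU); ring.
Qed.

Lemma Rm_hor_xi X Y V p : horizontal X -> horizontal Y -> ip (Rm D X Y xi) V p = 0.
Proof.
move=> hX hY; rewrite ip_kappa_mu; smooth_side.
by rewrite (horizontal_ip p hX) (horizontal_ip p hY); ring.
Qed.

Lemma ip_h_self X p : horizontal X ->
  ip (hten X) X p = - (ip (D X xi) (phi X) p + ip (D (phi X) xi) X p) / 2.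
Proof.
move=> hX; have sX := proj1 hX.
rewrite ip_h; smooth_side; rewrite ip_phi_skew; smooth_side.
by field.
Qed.

Lemma ip_h_phi X p : horizontal X ->
  ip (hten X) (phi X) p = (ip (D X xi) X p - ip (D (phi X) xi) (phi X) p) / 2.
Proof.
move=> hX; have sX := proj1 hX.
rewrite ip_h; smooth_side; rewrite ip_phi2; smooth_side.
by rewrite (horizontal_ip _ hX) mulr0 subr0.
Qed.

Lemma ip_h_phi_l X p : horizontal X ->
  ip (hten (phi X)) X p = (ip (D X xi) X p - ip (D (phi X) xi) (phi X) p) / 2.
Proof.
move=> hX; have sX := proj1 hX.
have := ip_h_phi p (horizontal_phi sX); rewrite (horizontal_phi2 hX) (DZl lcD); smooth_side.
by rewrite !ipZl !ipZr => e; lra.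
Qed.

Lemma ip_h_phi_phi X p : horizontal X ->
  ip (hten (phi X)) (phi X) p = - ip (hten X) X p.
Proof.
move=> hX; have sX := proj1 hX.
rewrite (ip_h_self _ hX) (ip_h_self _ (horizontal_phi sX)) (horizontal_phi2 hX).
rewrite (DZl lcD); smooth_side.
by rewrite !ipZl !ipZr; field.
Qed.

(** The Riccati equation for D xi along the Reeb flow, with products expanded in the frame
    of X. *)
Lemma Rm_xi_frame X U V p : horizontal X -> smooth_vf U -> smooth_vf V ->
  ip X X p * ip (Rm D U xi xi) V p =
  - (ip X X p * dir xi (ip (D U xi) V) p)
  + (ip (D U xi) X p * ip (D xi V) X p + ip (D U xi) (phi X) p * ip (D xi V) (phi X) p)
  - (ip (D U xi) X p * ip (D X xi) V p + ip (D U xi) (phi X) p * ip (D (phi X) xi) V p)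
  + (ip (D xi U) X p * ip (D X xi) V p + ip (D xi U) (phi X) p * ip (D (phi X) xi) V p).
Proof.
move=> hX sU sV; have sX := proj1 hX.
have x0 W : ip (D xi xi) W p = 0 by exact: ip_zero_l (D_xi_xi lcD p).
rewrite (Rm_xi lcD _ sU sV) !mulrDr !mulrN (ip_frame _ _ _ hX)
  (ip_Dxi_xi lcD _ sU) !(D_frame _ _ hX); smooth_side.
by rewrite !x0; ring.
Qed.

Lemma D_xi_phi_off X p : horizontal X ->
  ip (D xi (phi X)) X p = - ip (D xi X) (phi X) p.
Proof.
move=> hX; have sX := proj1 hX; rewrite dir_ip0; smooth_side => //.
by move=> q; rewrite ipC ip_phi_self.
Qed.

(** The divergence of xi vanishes.  Both kappa and mu h are symmetric, so the antisymmetric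
    part of R(., xi) xi is zero; the Riccati equation expresses this part as a multiple of
    (div xi) d eta. *)
Lemma trace_Dxi X p : horizontal X ->
  ip (D X xi) X p + ip (D (phi X) xi) (phi X) p = 0.
Proof.
move=> hX; have sX := proj1 hX; have sx := @smooth_xi _ _ M.
have [f0|f0] := eqVneq (ip X X p) 0.
  by rewrite (ip_zero_r _ f0) ip_zero_r ?(ip_phi_phi _ hX) ?addr0.
have R12 := Rm_xi_frame p hX sX (smooth_phi sX).
have R21 := Rm_xi_frame p hX (smooth_phi sX) sX.
rewrite (Rm_xi_km _ _ hX) (ip_h_phi _ hX) (ip_phi_self _ sX) (D_xi_phi_off _ hX)
  (D_norm_phi _ hX sx) (D_norm _ sX sx) in R12.
rewrite (Rm_xi_km _ _ (horizontal_phi sX)) (ip_h_phi_l _ hX) (ipC (phi X) X) (ip_phi_self _ sX)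
  (D_xi_phi_off _ hX) (D_norm_phi _ hX sx) (D_norm _ sX sx) in R21.
have vE : dir xi (ip (D X xi) (phi X)) p =
    dir xi (ip (D (phi X) xi) X) p + (- 2) * dir xi (ip X X) p.
  have -> : ip (D X xi) (phi X) = fun q => ip (D (phi X) xi) X q + (- 2) * ip X X q.
    by apply/funext => q; have := Dxi_off q hX => e; lra.
  by rewrite dirD ?dirZ; smooth_side.
have off := Dxi_off p hX.
rewrite vE {vE} in R12.
move: f0 R12 R21 off.
set f := ip X X p; set b := ip (D X xi) (phi X) p; set c := ip (D (phi X) xi) X p.
set a := ip (D X xi) X p; set d := ip (D (phi X) xi) (phi X) p.
move=> f0 R12 R21 off; apply: (mulfI f0); rewrite mulr0.
have bE : b = c - 2 * f by lra.
by rewrite bE in R12; lra.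
Qed.

(** This is |h X|^2 = (1 - kappa) |X|^2: the left side is 4 (<h X, X>^2 + <h X, phi X>^2).
    It is the trace over the contact plane of the Riccati equation, in which h does not
    contribute to R(., xi) xi since its trace is zero. *)
Lemma norm_Dxi X p : horizontal X ->
  (ip (D X xi) (phi X) p + ip (D (phi X) xi) X p) ^+ 2 + (2 * ip (D X xi) X p) ^+ 2
  = (1 - kappa) * (2 * ip X X p) ^+ 2.
Proof.
move=> hX; have sX := proj1 hX; have sx := @smooth_xi _ _ M.
have [f0|f0] := eqVneq (ip X X p) 0.
  rewrite !(ip_zero_r _ f0) ip_zero_r ?(ip_phi_phi _ hX) //.
  by ring.
have R11 := Rm_xi_frame p hX sX sX.
have R22 := Rm_xi_frame p hX (smooth_phi sX) (smooth_phi sX).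
rewrite (Rm_xi_km _ _ hX) (D_norm _ sX sx) in R11.
rewrite (Rm_xi_km _ _ (horizontal_phi sX)) (ip_phi_phi _ hX) (ip_h_phi_phi _ hX)
  (D_xi_phi_off _ hX) (D_norm_phi _ hX sx) in R22.
have vE : dir xi (ip (D (phi X) xi) (phi X)) p = (- 1) * dir xi (ip (D X xi) X) p.
  have -> : ip (D (phi X) xi) (phi X) = fun q => (- 1) * ip (D X xi) X q.
    by apply/funext => q; have := trace_Dxi q hX => e; lra.
  by rewrite dirZ; smooth_side.
have off := Dxi_off p hX; have tr := trace_Dxi p hX.
rewrite vE {vE} in R22.
move: f0 R11 R22 off tr.
set f := ip X X p; set b := ip (D X xi) (phi X) p; set c := ip (D (phi X) xi) X p.
set a := ip (D X xi) X p; set d := ip (D (phi X) xi) (phi X) p.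
move=> f0 R11 R22 off tr.
have bE : b = c - 2 * f by lra.
have dE : d = - a by lra.
move: R11 R22; rewrite bE dE => R11 R22; nra.
Qed.

End ThreeDim.

(** * Eigenframes of h and the curvature of the contact planes *)

Section Eigenframe.
Variables (R : realType) (M : contactMetricManifold R 1) (D : connection M).
Hypothesis lcD : levi_civita (cm_g M) D.
Variables kappa mu : R.
Hypothesis km : kappa_mu D kappa mu.
Implicit Types (X Y Z V W U E : vfield M) (p q : M) (u : M -> R) (l : R).

Local Notation ip := (@inner _ _ M).
Local Notation phi := (@rot _ _ M).
Local Notation xi := (cm_xi M).

(** These are the components of D xi in the frame (E, phi E) when h E = l E and
    h (phi E) = - l phi E, because D_V xi = - phi V - phi (h V). *)
Definition eigenframe l E := horizontal E /\ forall q,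
  [/\ ip (D E xi) E q = 0, ip (D (phi E) xi) (phi E) q = 0,
      ip (D E xi) (phi E) q = - (1 + l) * ip E E q
    & ip (D (phi E) xi) E q = (1 - l) * ip E E q].

Lemma kappa_le1 p : kappa <= 1.
Proof.
have [X hX f0] := exists_horizontal p.
have N := norm_Dxi lcD km p hX.
have f2 : 0 < (2 * ip X X p) ^+ 2 by rewrite exprn_gt0 // mulr_gt0.
have : 0 <= (1 - kappa) * (2 * ip X X p) ^+ 2 by rewrite -N addr_ge0 // sqr_ge0.
by rewrite pmulr_lge0 // subr_ge0.
Qed.

Lemma eigenframe_kappa1 X : kappa = 1 -> horizontal X -> eigenframe 0 X.
Proof.
move=> k1 hX; split=> // q.
have N := norm_Dxi lcD km q hX; have T := trace_Dxi lcD km q hX; have O := Dxi_off lcD q hX.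
move: N; rewrite k1 subrr mul0r => /eqP.
rewrite paddr_eq0 ?sqr_ge0 // !sqrf_eq0 => /andP[/eqP s /eqP a].
by split; lra.
Qed.

(** |X|^2 (h X + l X), which h multiplies by l because h^2 = l^2 on the contact planes.  The
    factor |X|^2 makes the coefficients smooth. *)
Definition eigen_field l X : vfield M :=
  vscale (fun q => - 2^-1 * (ip (D X xi) (phi X) q + ip (D (phi X) xi) X q) + l * ip X X q) X
  \+ vscale (ip (D X xi) X) (phi X).

Lemma eigen_fieldP l X : l ^+ 2 = 1 - kappa -> horizontal X -> eigenframe l (eigen_field l X).
Proof.
move=> l2 hX; have sX := proj1 hX; rewrite /eigen_field.
set cu := (fun q => _ + _); set cv := ip (D X xi) X.
have su : smooth cu by rewrite /cu; smoothness.
have sv : smooth cv by rewrite /cv; smoothness.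
have pE : phi (vscale cu X \+ vscale cv (phi X)) = vscale cu (phi X) \+ vscale (fun q => - cv q) X.
  rewrite phiD !phiZ horizontal_phi2 //.
  congr (_ \+ _); apply/funext => q; by rewrite /vscale scalerA mulrN1.
have snv : smooth (fun q => - cv q).
  have -> : (fun q => - cv q) = (fun q => -1 * cv q) by apply/funext => q; rewrite mulN1r.
  by smoothness.
split.
  have hE q : ip (vscale cu X \+ vscale cv (phi X)) xi q = 0.
    by rewrite ipDl !ipZl (horizontal_ip q hX) (ip_phi_xi q sX) !mulr0 addr0.
  split; first by smoothness.
  by move=> q; have := hE q; rewrite inner.unlock.
move=> q; rewrite !pE !(DDl lcD); smooth_side.
rewrite !(DZl lcD); smooth_side.
rewrite !ipDl !ipDr !ipZl !ipZr.
have N := norm_Dxi lcD km q hX; have T := trace_Dxi lcD km q hX; have O := Dxi_off lcD q hX.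
rewrite (ip_phi_phi q hX) (ip_phi_self q sX) (ipC (phi X) X) (ip_phi_self q sX).
have uq : cu q = - 2^-1 * (ip (D X xi) (phi X) q + ip (D (phi X) xi) X q) + l * ip X X q by [].
have vq : cv q = ip (D X xi) X q by [].
rewrite -vq -l2 in N T *; move: N T O uq.
set f := ip X X q; set b := ip (D X xi) (phi X) q; set c := ip (D (phi X) xi) X q.
set d := ip (D (phi X) xi) (phi X) q; move: (cu q) (cv q) => u v N T O uq.
have dE : d = - v by lra.
have bE : b = c - 2 * f by lra.
have cE : c = f - u + l * f by rewrite uq bE; field.
(* The relation |h X|^2 = l^2 |X|^2, with <h X, X> = u - l f and <h X, phi X> = v. *)
have P : u ^+ 2 - 2 * (u - l * f) * u - v ^+ 2 = 0.
  by move: N; rewrite bE cE => N; nra.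
rewrite dE bE cE.
split.
- transitivity (v * (u ^+ 2 - 2 * (u - l * f) * u - v ^+ 2)); first by ring.
  by rewrite P mulr0.
- transitivity (- v * (u ^+ 2 - 2 * (u - l * f) * u - v ^+ 2)); first by ring.
  by rewrite P mulr0.
- apply/eqP; rewrite -subr_eq0; apply/eqP.
  transitivity (u * (u ^+ 2 - 2 * (u - l * f) * u - v ^+ 2)); last by rewrite P mulr0.
  by ring.
- apply/eqP; rewrite -subr_eq0; apply/eqP.
  transitivity (u * (u ^+ 2 - 2 * (u - l * f) * u - v ^+ 2)); last by rewrite P mulr0.
  by ring.
Qed.

(** If h X + l X vanishes at p, then h X = - l X there, so h (phi X) = l phi X and the field
    built from phi X has the value 2 l |X|^2 phi X at p. *)
Lemma exists_eigenframe l p : l ^+ 2 = 1 - kappa -> 0 < l ->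
  exists2 E, eigenframe l E & ip E E p != 0.
Proof.
move=> l2 l0; have [X hX f0] := exists_horizontal p.
have sX := proj1 hX; have hY := horizontal_phi sX.
have norm Z : horizontal Z -> ip (eigen_field l Z) (eigen_field l Z) p =
   ((- 2^-1 * (ip (D Z xi) (phi Z) p + ip (D (phi Z) xi) Z p) + l * ip Z Z p) ^+ 2
    + ip (D Z xi) Z p ^+ 2) * ip Z Z p.
  move=> hZ; have sZ := proj1 hZ; rewrite /eigen_field !ipDl !ipDr !ipZl !ipZr.
  by rewrite (ip_phi_phi p hZ) (ip_phi_self p sZ) (ipC (phi Z) Z) (ip_phi_self p sZ); ring.
have [e|ne] := eqVneq (ip (eigen_field l X) (eigen_field l X) p) 0; last first.
  by exists (eigen_field l X) => //; exact: eigen_fieldP.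
exists (eigen_field l (phi X)); first exact: eigen_fieldP.
move/eqP: e; rewrite !norm // (ip_phi_phi p hX) !(horizontal_phi2 hX).
rewrite (DZl lcD); smooth_side; rewrite ipZl ipZr.
rewrite mulf_eq0 (gt_eqF f0) orbF paddr_eq0 ?sqr_ge0 // sqrf_eq0 => /andP[/eqP e _].
rewrite mulf_neq0 ?gt_eqF // ltr_pwDl ?sqr_ge0 // exprn_gt0 //.
have := mulr_gt0 l0 f0; move: e.
by lra.
Qed.

Section Frame.
Variables (l : R) (E : vfield M).
Hypothesis fE : eigenframe l E.
Let hE : horizontal E := proj1 fE.
Let sE : smooth_vf E := proj1 hE.
Let hF : horizontal (phi E) := horizontal_phi sE.

Lemma ip_frame_zero p V : ip E E p = 0 -> ip V E p = 0 /\ ip V (phi E) p = 0.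
Proof.
move=> f0; rewrite ip_zero_r //; split=> //.
by rewrite ip_zero_r // ip_phi_phi.
Qed.

Lemma Dxi_E V p : smooth_vf V -> ip (D V xi) E p = (1 - l) * ip V (phi E) p.
Proof.
move=> sV; have [f0|f0] := eqVneq (ip E E p) 0.
  by have [-> _] := ip_frame_zero (D V xi) f0; have [_ ->] := ip_frame_zero V f0; rewrite mulr0.
have [s11 _ _ s21] := (proj2 fE) p.
apply: (mulfI f0); rewrite (D_frame lcD _ _ hE); smooth_side.
by rewrite s11 s21 (ip_zero_l _ (D_xi_xi lcD p)); ring.
Qed.

Lemma Dxi_F V p : smooth_vf V -> ip (D V xi) (phi E) p = - (1 + l) * ip V E p.
Proof.
move=> sV; have [f0|f0] := eqVneq (ip E E p) 0.
  by have [_ ->] := ip_frame_zero (D V xi) f0; have [-> _] := ip_frame_zero V f0; rewrite mulr0.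
have [_ s22 s12 _] := (proj2 fE) p.
apply: (mulfI f0); rewrite (D_frame lcD _ _ hE); smooth_side.
by rewrite s22 s12 (ip_zero_l _ (D_xi_xi lcD p)); ring.
Qed.

Lemma ip_Dxi V W p : smooth_vf V ->
  ip E E p * ip (D V xi) W p =
  (1 - l) * ip V (phi E) p * ip W E p - (1 + l) * ip V E p * ip W (phi E) p.
Proof.
move=> sV; rewrite (ip_frame _ _ _ hE) (Dxi_E _ sV) (Dxi_F _ sV) (ip_Dxi_xi lcD _ sV).
by ring.
Qed.

Lemma D_EF V p : smooth_vf V -> ip (D V E) (phi E) p = - ip (D V (phi E)) E p.
Proof.
move=> sV; rewrite (dir_ip0 lcD); smooth_side => //.
by move=> q; exact: ip_phi_self.
Qed.

Lemma dir_Dxi_EE W p : dir W (ip (D E xi) E) p = 0.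
Proof.
have -> : ip (D E xi) E = fun=> 0 by apply/funext => q; have [] := (proj2 fE) q.
exact: dir_cst.
Qed.

Lemma dir_Dxi_FF W p : dir W (ip (D (phi E) xi) (phi E)) p = 0.
Proof.
have -> : ip (D (phi E) xi) (phi E) = fun=> 0 by apply/funext => q; have [] := (proj2 fE) q.
exact: dir_cst.
Qed.

Lemma dir_Dxi_EF W p : dir W (ip (D E xi) (phi E)) p = - (1 + l) * dir W (ip E E) p.
Proof.
have -> : ip (D E xi) (phi E) = fun q => - (1 + l) * ip E E q.
  by apply/funext => q; have [] := (proj2 fE) q.
by rewrite dirZ; smooth_side.
Qed.

Lemma dir_Dxi_FE W p : dir W (ip (D (phi E) xi) E) p = (1 - l) * dir W (ip E E) p.
Proof.
have -> : ip (D (phi E) xi) E = fun q => (1 - l) * ip E E q.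
  by apply/funext => q; have [] := (proj2 fE) q.
by rewrite dirZ; smooth_side.
Qed.

Hypothesis l0 : l != 0.

(** The component along E of R(E, phi E) xi = 0 is - 2 l <D_F E, F>, with F = phi E. *)
Lemma conn_F p : ip (D (phi E) (phi E)) E p = 0.
Proof.
have [f0|f0] := eqVneq (ip E E p) 0; first by have [] := ip_frame_zero (D (phi E) (phi E)) f0.
have := Rm_hor_xi km E p hE hF; rewrite (Rm_expand lcD); smooth_side.
rewrite dir_Dxi_FE dir_Dxi_EE !Dxi_E; smooth_side.
rewrite (D_EF p (proj1 hF)) (D_norm_phi lcD _ hE sE).
have A := ip_Dxi (D E E) p (proj1 hF); have B := ip_Dxi (D (phi E) E) p sE.
rewrite (ip_phi_phi p hE) (ipC (phi E) E) (ip_phi_self p sE) (D_norm lcD _ sE sE) in A.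
rewrite (ip_phi_self p sE) (D_EF p (proj1 hF)) in B.
move=> /(congr1 ( *%R (ip E E p))); rewrite mulr0 => H.
have {}H : ip E E p * l * ip (D (phi E) (phi E)) E p = 0 by lra.
by move/eqP: H; rewrite !mulf_eq0 (negPf f0) (negPf l0) => /eqP.
Qed.

(** The component along phi E of the same equation. *)
Lemma conn_E p : ip (D E (phi E)) E p = 0.
Proof.
have [f0|f0] := eqVneq (ip E E p) 0; first by have [] := ip_frame_zero (D E (phi E)) f0.
have := Rm_hor_xi km (phi E) p hE hF; rewrite (Rm_expand lcD); smooth_side.
rewrite dir_Dxi_FF dir_Dxi_EF !Dxi_F; smooth_side.
rewrite (D_norm lcD _ sE (proj1 hF)).
have A := ip_Dxi (D E (phi E)) p (proj1 hF); have B := ip_Dxi (D (phi E) (phi E)) p sE.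
rewrite (ip_phi_phi p hE) (ipC (phi E) E) (ip_phi_self p sE) in A.
rewrite (ip_phi_self p sE) (D_norm_phi lcD _ hE (proj1 hF)) in B.
move=> /(congr1 ( *%R (ip E E p))); rewrite mulr0 => H.
have {}H : ip E E p * l * ip (D E (phi E)) E p = 0 by lra.
by move/eqP: H; rewrite !mulf_eq0 (negPf f0) (negPf l0) => /eqP.
Qed.

Hypothesis l2 : l ^+ 2 = 1 - kappa.

(** Here R(E, xi) xi is paired with E, and h E = l E. *)
Lemma conn_xi p : ip (D xi (phi E)) E p = mu / 2 * ip E E p.
Proof.
have [f0|f0] := eqVneq (ip E E p) 0.
  by rewrite f0 mulr0; have [] := ip_frame_zero (D xi (phi E)) f0.
have [s11 s22 s12 s21] := (proj2 fE) p.
have := Rm_xi_frame lcD p hE sE sE.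
rewrite (Rm_xi_km km _ _ hE) (ip_h_self lcD _ hE) dir_Dxi_EE s11 s12 s21.
rewrite (D_EF p (@smooth_xi _ _ M)) => H.
apply: (mulfI l0); apply: (mulfI f0).
have kE : kappa = 1 - l ^+ 2 by rewrite l2 subKr.
move: H; rewrite kE.
move: (ip E E p) (ip (D xi (phi E)) E p) (ip (D xi E) E p) => f w r H.
apply/eqP; rewrite -subr_eq0; apply/eqP.
transitivity (- 2^-1 * (f * ((1 - l ^+ 2) * f + mu * (- (- (1 + l) * f + (1 - l) * f) / 2))
  - (- (f * 0) + (0 * r + - (1 + l) * f * - w) - (0 * 0 + - (1 + l) * f * ((1 - l) * f))
     + (r * 0 + - w * ((1 - l) * f))))); first by field.
by rewrite H subrr mulr0.
Qed.

(** V |-> <D_V (phi E), E> is a 1-form, known on the frame. *)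
Lemma conn_form V p : smooth_vf V ->
  ip (D V (phi E)) E p = mu / 2 * (ip V xi p * ip E E p).
Proof.
move=> sV; have [f0|f0] := eqVneq (ip E E p) 0.
  by rewrite f0 !mulr0; have [] := ip_frame_zero (D V (phi E)) f0.
apply: (mulfI f0); rewrite (D_frame lcD _ _ hE); smooth_side.
by rewrite conn_E conn_F conn_xi; ring.
Qed.

(** Cartan's structure equation in the plane of E and phi E.  The exterior derivative of the
    connection form contributes mu d eta; the normal components of D E and D (phi E),
    which are given by D xi, contribute (1 - l) (1 + l) = kappa. *)
Lemma Rm_FE X Y p : smooth_vf X -> smooth_vf Y -> ip E E p != 0 ->
  ip (Rm D X Y (phi E)) E p =
  - (kappa + mu) * (ip X E p * ip Y (phi E) p - ip Y E p * ip X (phi E) p).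
Proof.
move=> sX sY f0; rewrite (Rm_expand lcD); smooth_side.
have dW Z V : smooth_vf Z -> smooth_vf V -> dir V (ip (D Z (phi E)) E) p =
    mu / 2 * (ip Z xi p * dir V (ip E E) p + dir V (ip Z xi) p * ip E E p).
  move=> sZ sV.
  have -> : ip (D Z (phi E)) E = fun q => mu / 2 * (ip Z xi q * ip E E q).
    by apply/funext => q; exact: conn_form.
  by rewrite dirZ ?dirM; smooth_side.
have cross Z V : smooth_vf Z -> smooth_vf V ->
    ip E E p * ip (D Z (phi E)) (D V E) p =
    mu / 2 * (ip Z xi p * ip E E p) * (dir V (ip E E) p / 2)
    - dir Z (ip E E) p / 2 * (mu / 2 * (ip V xi p * ip E E p))
    - ip E E p * ((1 - l ^+ 2) * ip Z E p * ip V (phi E) p).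
  move=> sZ sV; rewrite (ip_frame _ _ _ hE) (D_EF p sV) !conn_form //.
  rewrite (D_norm lcD _ sE sV) (D_norm_phi lcD _ hE sZ).
  rewrite (dir_ip0 lcD (Y := xi) _ (proj1 hF)); smooth_side; last first.
    by move=> q; exact: horizontal_ip.
  rewrite (dir_ip0 lcD (Y := xi) _ sE); smooth_side; last first.
    by move=> q; exact: horizontal_ip.
  by rewrite Dxi_E // Dxi_F //; ring.
have deta : dir X (ip Y xi) p - dir Y (ip X xi) p - ip (D X Y) xi p + ip (D Y X) xi p
    = 2 * ip X (phi Y) p.
  rewrite -(Dxi_antisym lcD _ sX sY) !(dir_ip lcD); smooth_side.
  by rewrite (ipC Y) (ipC X); ring.
have fXY : ip E E p * ip X (phi Y) p = ip Y E p * ip X (phi E) p - ip X E p * ip Y (phi E) p.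
  rewrite (ip_frame _ _ _ hE) (ip_phi_xi p sY) (ip_phi_skew p sY sE).
  by rewrite (ip_phi2 p sY sE) (horizontal_ip p hE); ring.
have C1 := cross Y X sY sX; have C2 := cross X Y sX sY.
rewrite !dW // !conn_form; smooth_side.
apply: (mulfI f0).
have kE : kappa = 1 - l ^+ 2 by rewrite l2 subKr.
rewrite kE.
move: deta fXY C1 C2.
set P1 := ip (D Y (phi E)) (D X E) p; set P2 := ip (D X (phi E)) (D Y E) p.
set a := dir X (ip Y xi) p; set b := dir Y (ip X xi) p.
set c := ip (D X Y) xi p; set d := ip (D Y X) xi p.
set y := ip Y xi p; set x := ip X xi p; set f := ip E E p.
set fx := dir X (ip E E) p; set fy := dir Y (ip E E) p; set s := ip X (phi Y) p.
move=> deta fXY C1 C2.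
transitivity (mu / 2 * f * f * (a - b - c + d) + mu / 2 * f * (y * fx - x * fy) - f * P1 + f * P2).
  by ring.
rewrite deta C1 C2.
transitivity (mu * f * (f * s) + mu / 2 * f * (y * fx - x * fy)
  - (mu / 2 * (y * f) * (fx / 2) - fy / 2 * (mu / 2 * (x * f))
     - f * ((1 - l ^+ 2) * ip Y E p * ip X (phi E) p))
  + (mu / 2 * (x * f) * (fy / 2) - fx / 2 * (mu / 2 * (y * f))
     - f * ((1 - l ^+ 2) * ip X E p * ip Y (phi E) p))); first by field.
by rewrite fXY; field.
Qed.

(** In the plane of E and phi E a skew operator is determined by one entry. *)
Lemma Rm_eigenframe X Y Z V p : smooth_vf X -> smooth_vf Y -> horizontal Z -> horizontal V ->
  ip E E p != 0 ->
  ip (Rm D X Y Z) V p = - (kappa + mu) * (ip Y Z p * ip X V p - ip X Z p * ip Y V p).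
Proof.
move=> sX sY hZ hV f0; have sZ := proj1 hZ; have sV := proj1 hV.
have Q := Rm_FE sX sY f0.
have EE W : smooth_vf W -> ip (Rm D X Y W) W p = 0.
  by move=> sW; have := Rm_skew lcD p sX sY sW sW => e; lra.
have QE : ip E E p * ip (Rm D X Y Z) E p = ip Z (phi E) p * ip (Rm D X Y (phi E)) E p.
  rewrite (Rm_skew lcD); smooth_side; rewrite mulrN.
  rewrite (ip_frame _ _ _ hE) (horizontal_ip p hZ) (EE _ sE).
  rewrite (Rm_skew lcD p sX sY sE (proj1 hF)); by ring.
have QF : ip E E p * ip (Rm D X Y Z) (phi E) p = - (ip Z E p * ip (Rm D X Y (phi E)) E p).
  rewrite (Rm_skew lcD); smooth_side; rewrite mulrN.
  rewrite (ip_frame _ _ _ hE) (horizontal_ip p hZ) (EE _ (proj1 hF)).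
  by ring.
apply: (mulfI f0); apply: (mulfI f0).
have RZV : ip E E p * (ip E E p * ip (Rm D X Y Z) V p) =
    (ip E E p * ip (Rm D X Y Z) E p) * ip V E p
    + (ip E E p * ip (Rm D X Y Z) (phi E) p) * ip V (phi E) p.
  by rewrite (ip_frame _ (Rm D X Y Z) _ hE) (horizontal_ip p hV); ring.
have split U W : horizontal W -> ip E E p * ip U W p =
    ip U E p * ip W E p + ip U (phi E) p * ip W (phi E) p.
  by move=> hW; rewrite (ip_frame _ _ _ hE) (horizontal_ip p hW); ring.
rewrite RZV QE QF Q.
transitivity (- (kappa + mu) * ((ip E E p * ip Y Z p) * (ip E E p * ip X V p)
  - (ip E E p * ip X Z p) * (ip E E p * ip Y V p))); last by ring.
rewrite !(split _ Z hZ) !(split _ V hV).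
by ring.
Qed.

End Frame.

Lemma Rm_horizontal X Y Z V p : kappa < 1 ->
  smooth_vf X -> smooth_vf Y -> horizontal Z -> horizontal V ->
  ip (Rm D X Y Z) V p = - (kappa + mu) * (ip Y Z p * ip X V p - ip X Z p * ip Y V p).
Proof.
move=> k1 sX sY hZ hV.
have k0 : 0 < 1 - kappa by rewrite subr_gt0.
have l0 : 0 < Num.sqrt (1 - kappa) by rewrite sqrtr_gt0.
have l2 : Num.sqrt (1 - kappa) ^+ 2 = 1 - kappa by rewrite sqr_sqrtr // ltW.
have [E fE f0] := exists_eigenframe p l2 l0.
by apply: (Rm_eigenframe fE _ l2) => //; rewrite gt_eqF.
Qed.

(** The formula survives an arbitrary last argument, since R(X, Y) xi = 0 for X, Y
    horizontal makes R(X, Y) Z horizontal. *)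
Lemma Rm_horizontal3 X Y Z V p : kappa < 1 ->
  horizontal X -> horizontal Y -> horizontal Z -> smooth_vf V ->
  ip (Rm D X Y Z) V p = - (kappa + mu) * (ip Y Z p * ip X V p - ip X Z p * ip Y V p).
Proof.
move=> k1 hX hY hZ sV; have sX := proj1 hX; have sY := proj1 hY; have sZ := proj1 hZ.
have [E hE f0] := exists_horizontal p; have hF := horizontal_phi (proj1 hE).
apply: (mulfI (negbT (gt_eqF f0))).
have RZV : ip E E p * ip (Rm D X Y Z) V p =
    ip (Rm D X Y Z) E p * ip V E p + ip (Rm D X Y Z) (phi E) p * ip V (phi E) p.
  rewrite (ip_frame _ _ _ hE) (Rm_skew lcD p sX sY sZ (@smooth_xi _ _ M)).
  by rewrite (Rm_hor_xi km _ _ hX hY); ring.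
rewrite RZV (Rm_horizontal _ k1 sX sY hZ hE) (Rm_horizontal _ k1 sX sY hZ hF).
have split U W : horizontal W -> ip E E p * ip W U p =
    ip U E p * ip W E p + ip U (phi E) p * ip W (phi E) p.
  by move=> hW; rewrite (ip_frame _ _ _ hE) (horizontal_ip p hW); ring.
transitivity (- (kappa + mu) * (ip Y Z p * (ip E E p * ip X V p)
  - ip X Z p * (ip E E p * ip Y V p))); last by ring.
by rewrite !split //; ring.
Qed.

(** Each of the four arguments may be replaced by its derivative along W, horizontal or
    not, in one of the two preceding formulas; the product rule for <Y, Z> <X, V> and
    <X, Z> <Y, V> then cancels everything. *)
Lemma dcurv_horizontal W X Y Z V p : kappa < 1 ->
  horizontal W -> horizontal X -> horizontal Y -> horizontal Z -> horizontal V ->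
  ip (dcurv D W X Y Z) V p = 0.
Proof.
move=> k1 hW hX hY hZ hV.
have [sW sX sY sZ sV] : [/\ smooth_vf W, smooth_vf X, smooth_vf Y, smooth_vf Z & smooth_vf V].
  by split; smoothness.
have RE : curv D = Rm D by rewrite Rm.unlock.
rewrite /dcurv RE !ipBl.
have -> : ip (D W (Rm D X Y Z)) V p = dir W (ip (Rm D X Y Z) V) p - ip (Rm D X Y Z) (D W V) p.
  by rewrite (dir_ip lcD); smooth_side; rewrite addrK.
have -> : ip (Rm D X Y Z) V =
    fun q => - (kappa + mu) * (ip Y Z q * ip X V q + (-1) * (ip X Z q * ip Y V q)).
  by apply/funext => q; rewrite Rm_horizontal //; ring.
rewrite dirZ; smooth_side.
rewrite dirD; smooth_side.
rewrite dirM; smooth_side.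
rewrite dirZ; smooth_side.
rewrite dirM; smooth_side.
rewrite !(dir_ip lcD); smooth_side.
rewrite (Rm_skew lcD p sX sY (smooth_D lcD sW sZ) sV).
rewrite (Rm_horizontal3 p k1 hX hY hZ (smooth_D lcD sW sV)).
rewrite (Rm_horizontal3 p k1 hX hY hV (smooth_D lcD sW sZ)).
rewrite (Rm_horizontal p k1 (smooth_D lcD sW sX) sY hZ hV).
rewrite (Rm_horizontal p k1 sX (smooth_D lcD sW sY) hZ hV).
by ring.
Qed.

(** phi^2 N is horizontal, so N is orthogonal to it, and <N, phi^2 N> = - |phi N|^2. *)
Lemma locally_symmetric : kappa < 1 -> locally_phi_symmetric D.
Proof.
move=> k1 W X Y Z p hW hX hY hZ.
have -> : ev11 (cm_phi M) = phi by rewrite rot.unlock.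
have sN : smooth_vf (dcurv D W X Y Z).
  have RE : curv D = Rm D by rewrite Rm.unlock.
  by rewrite /dcurv RE; smoothness.
have hV := horizontal_phi (smooth_phi sN).
have := dcurv_horizontal p k1 hW hX hY hZ hV; move: (dcurv D W X Y Z) sN {hV} => N sN.
rewrite (ipC N) (ip_phi_skew p (smooth_phi sN) sN) => /eqP; rewrite oppr_eq0 => /eqP /ip_eq0 e.
by rewrite rotE e mul0mx.
Qed.

(** Every horizontal field is now an eigenfield for 0, that is, D_V xi = - phi V. *)
Lemma hten_kappa1 X p : kappa = 1 -> smooth_vf X -> hten X p = 0.
Proof.
move=> k1 sX; have [E hE f0] := exists_horizontal p.
have fE := eigenframe_kappa1 k1 hE; have sE := proj1 hE.
apply: ip_nondeg; last first.
  have -> : hten X = vscale (fun=> 2^-1) (phi (D X xi) \- D (phi X) xi).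
    by apply/funext => q; exact: (htenE lcD _ sX).
  by smoothness.
move=> V sV; rewrite (ip_h lcD _ sX sV) (ip_phi_skew p (smooth_D lcD sX (@smooth_xi _ _ M)) sV).
apply: (mulfI (negbT (gt_eqF f0))).
have A := ip_Dxi fE (phi V) p sX; have B := ip_Dxi fE V p (smooth_phi sX).
rewrite !(ip_phi_skew p _ sE) // !(ip_phi2 p _ sE) // (horizontal_ip p hE) in A B.
move: A B; set a := ip (D X xi) (phi V) p; set b := ip (D (phi X) xi) V p => A B.
transitivity (- (ip E E p * a + ip E E p * b) / 2); first by field.
by rewrite A B; field.
Qed.

Lemma sasakian_kappa1 : kappa = 1 -> sasakian D.
Proof.
move=> k1 X Y p sX sY; have hE : @hten _ _ M = @cm_h _ _ M by rewrite hten.unlock.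
have := km p sX sY; rewrite -hE (hten_kappa1 p k1 sX) (hten_kappa1 p k1 sY) k1 => ->.
by rewrite !scaler0 subr0 scaler0 addr0 scale1r.
Qed.

End Eigenframe.

Theorem corollary4p8 (R : realType) :
  ~ (exists (M : contactMetricManifold R 1) (nabla : connection M)
            (kappa mu : R),
       levi_civita (cm_g M) nabla /\
       kappa_mu nabla kappa mu /\
       ~ sasakian nabla /\
       locally_phi_recurrent nabla /\
       ~ locally_phi_symmetric nabla).
Proof.
move=> [M [nabla [kappa [mu [lc [km [nsas [_ nsym]]]]]]]]; apply: nsym.
have [k1|k1] := eqVneq kappa 1; first by case: nsas; exact: sasakian_kappa1 km k1.
move=> W X Y Z p; apply: (locally_symmetric lc km).
by rewrite lt_neqAle k1 (kappa_le1 lc km p).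
Qed.
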